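(* Let $\mu$ be a mass distribution in $\mathbb{R}^3$ and let $v\in\mathbb{S}^2$. Then there exists an eight-partition $(H_1,H_2,H_3)$ of $\mu$ such that the intersection of the two planes $H_1$ and $H_2$ is a line in the direction of $v$.
   Context: A mass distribution in $\mathbb{R}^3$ is a finite measure such that every open set is measurable and every (affine) plane has measure zero. A triple $(H_1,H_2,H_3)$ of affine planes in $\mathbb{R}^3$, with open half-spaces $H_i^{+},H_i^{-}$ bounded by $H_i$, is an eight-partition of $\mu$ if each of the eight open octants $H_1^{\alpha_1}\cap H_2^{\alpha_2}\cap H_3^{\alpha_3}$, $\alpha\in\{+,-\}^3$, has measure exactly $\mu(\mathbb{R}^3)/8$. *)

(* Defs.v *)
From HB Require Import structures.
From mathcomp Require Import all_boot all_order all_algebra.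
From mathcomp Require Import all_classical all_reals all_analysis.

Set Implicit Arguments.
Unset Strict Implicit.
Unset Printing Implicit Defensive.

Import Order.TTheory GRing.Theory Num.Theory.
Import numFieldNormedType.Exports.

Local Open Scope classical_set_scope.
Local Open Scope ring_scope.

Definition dot (R : realType) (u w : 'rV[R]_3) : R :=
  \sum_(i < 3) u 0 i * w 0 i.

(* The library's norm on 'rV[R]_3 is the sup norm, whose unit sphere is not
   S^2; the sphere is therefore defined through the dot product. *)
Definition sphere2 (R : realType) : set 'rV[R]_3 := [set v | dot v v = 1].

(* The plane { x | dot normal x = offset }, together with the choice of
   positive side determined by the sign of the normal. *)
Record affine_plane (R : realType) := AffinePlane {
  normal : 'rV[R]_3;
  offset : R;
  normal_neq0 : normal != 0 }.

Definition plane_set (R : realType) (H : affine_plane R) : set 'rV[R]_3 :=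
  [set x | dot (normal H) x = offset H].

(* [true] stands for the side +, [false] for the side -. *)
Definition halfspace (R : realType) (H : affine_plane R) (a : bool) :
    set 'rV[R]_3 :=
  if a then [set x | offset H < dot (normal H) x]
  else [set x | dot (normal H) x < offset H].

Definition line (R : realType) (p v : 'rV[R]_3) : set 'rV[R]_3 :=
  [set x | exists t : R, x = p + t *: v].

(* Every sigma-algebra S is of the form <<s G>> (take G := S), so a finite
   measure on an arbitrary sigma-algebra of subsets of R^3 is a finite measure
   on [g_sigma_algebraType G] for some G. *)
Definition mass_distribution (R : realType) (G : set (set 'rV[R]_3))
    (mu : {finite_measure set (g_sigma_algebraType G) -> \bar R}) : Prop :=
  (forall U : set 'rV[R]_3, open U -> G.-sigma.-measurable U) /\
  (forall H : affine_plane R, mu (plane_set H) = 0%E).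

Definition eight_partition (R : realType) (G : set (set 'rV[R]_3))
    (mu : {finite_measure set (g_sigma_algebraType G) -> \bar R})
    (H1 H2 H3 : affine_plane R) : Prop :=
  forall a1 a2 a3 : bool,
    mu (halfspace H1 a1 `&` halfspace H2 a2 `&` halfspace H3 a3)
    = (mu [set: 'rV[R]_3] * (8^-1)%:E)%E.

(* Main.v *)
(* Take v as vertical direction and let [X], [Y] be affine functionals of the
   horizontal coordinates only, so that the planes X = 0 and Y = 0 are vertical.
   Assume first that the mass has full support.  For every direction of the line
   X = 0 there is exactly one such pair cutting the mass into four equal wedges:
   X is found from a median, and the slope of Y by the intermediate value theorem
   applied to the difference of the medians on the two sides of X = 0.

   For a pair of slopes (a, b), let m_ij be the median of z - a X - b Y on the
   wedge where X and Y have signs i and j.  Increasing a or b decreases m_++ and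
   increases m_--; increasing a or decreasing b decreases m_+- and increases m_-+.
   Two nested applications of the intermediate value theorem therefore give
   exactly one (a, b) with m_++ = m_-- and m_+- = m_-+, and it depends
   continuously on the direction.  It remains to make t = m_++ - m_+- vanish.
   Rotating the first line until it coincides with the second one permutes the
   wedges cyclically, so that t changes sign by uniqueness, and t vanishes for
   some intermediate direction.

   A general mass is perturbed by a small multiple of a Gaussian; the normalised
   coefficients of the planes stay in a compact set, and any cluster point works
   because planes have measure zero. *)
Require Import Defs.
From HB Require Import structures.
From mathcomp Require Import all_boot all_order all_algebra.
From mathcomp Require Import all_classical all_reals all_analysis.
From mathcomp Require Import measurable_realfun ring lra.

Import Order.TTheory GRing.Theory Num.Theory.
Import numFieldNormedType.Exports.

Local Open Scope classical_set_scope.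
Local Open Scope ring_scope.
Set Implicit Arguments.
Unset Strict Implicit.
Unset Printing Implicit Defensive.

(** * Masses and medians *)

Section mass.
Context {d : measure_display} {X : measurableType d} {R : realType}.
Variable nu : {measure set X -> \bar R}.
Hypothesis nu_fin : (nu setT < +oo)%E.

(** Real values make linear arithmetic and limits in [R] available; on measurable sets [massE] gives
    back the measure. *)
Definition mass (A : set X) : R := fine (nu A).

Lemma massE A : measurable A -> nu A = (mass A)%:E.
Proof.
move=> mA; rewrite /mass fineK// ge0_fin_numE//.
by apply: le_lt_trans nu_fin; apply: le_measure; rewrite ?inE.
Qed.

Lemma mass_ge0 A : 0 <= mass A.
Proof. exact: fine_ge0. Qed.

Lemma mass_set0 : mass set0 = 0.
Proof. by rewrite /mass measure0. Qed.

Lemma le_mass A B : measurable A -> measurable B -> A `<=` B -> mass A <= mass B.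
Proof.
by move=> mA mB AB; rewrite -lee_fin -!massE//; apply: le_measure; rewrite ?inE.
Qed.

Lemma massU A B : measurable A -> measurable B -> A `&` B = set0 ->
  mass (A `|` B) = mass A + mass B.
Proof.
move=> mA mB AB; apply: EFin_inj; rewrite EFinD -!massE ?measureU//.
exact: measurableU.
Qed.

(** Dominated convergence for indicator functions; the constant 1 dominates them and is integrable
    because [nu] is finite. *)
Lemma cvg_mass (A_ : (set X)^nat) (A : set X) :
  (forall n, measurable (A_ n)) -> measurable A ->
  {ae nu, forall x, \forall n \near \oo, A_ n x <-> A x} ->
  mass (A_ n) @[n --> \oo] --> mass A.
Proof.
move=> mA_ mA AA.
have [|||||_ _] := @dominated_convergence _ _ _ nu setT measurableT
  (fun n => EFin \o \1_(A_ n)) (EFin \o \1_A) (EFin \o cst 1).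
- by move=> n; apply/measurable_EFinP; exact: measurable_indic.
- by apply/measurable_EFinP; exact: measurable_indic.
- apply: filterS AA => x AAx _; apply: cvg_near_cst.
  apply: filterS AAx => n [AnA AAn] /=; congr EFin; rewrite !indicE.
  congr (_%:R); congr nat_of_bool; apply/idP/idP; rewrite !inE; tauto.
- apply/integrableP; split; first exact/measurable_EFinP.
  by under eq_integral do rewrite /= normr1; rewrite integral_cst// mul1e.
- apply: nearW => x n _ /=; rewrite lee_fin indicE.
  by case: (_ \in _); rewrite ?normr0 ?normr1.
rewrite /= integral_indic// setIT massE//.
under eq_cvg => n do rewrite integral_indic// setIT massE//.
by move/fine_cvgP => -[].
Qed.

End mass.

(** Dominated convergence speaks of sequences; this carries its conclusions over to neighbourhood
    filters. *)
Lemma cvg_sequentially {R : realType} {T : pseudoMetricType R} (F : T -> R) (t : T) :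
  (forall u : nat -> T, u n @[n --> \oo] --> t -> F (u n) @[n --> \oo] --> F t) ->
  F s @[s --> t] --> F t.
Proof.
move=> FP; apply/cvgrPdist_lt => e e0; apply: contrapT => nF.
(* A bad point in each ball of radius [n.+1%:R^-1] yields a sequence that tends to [t] while [F]
   stays at distance at least [e] from [F t]. *)
have /choice[u uP] : forall n, exists s,
    ball t n.+1%:R^-1 s /\ ~ (`|F t - F s| < e).
  move=> n; apply: contrapT => nu; apply: nF.
  apply/nbhs_ballP; exists n.+1%:R^-1; rewrite /= ?invr_gt0// => s ts.
  by apply: contrapT => ?; apply: nu; exists s.
have /FP/cvgrPdist_lt/(_ _ e0) [N _ /(_ N (leqnn N))] : u n @[n --> \oo] --> t.
  apply/cvg_ballP => r r0; near=> n.
  apply: (@le_ball _ _ _ n.+1%:R^-1); last by case: (uP n).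
  by apply/ltW; near: n; exact: (near_infty_natSinv_lt (PosNum r0)).
by case: (uP N).
Unshelve. all: by end_near. Qed.

Lemma measurable_lt_set {d} {X : measurableType d} {R : realType} (f g : X -> R) :
  measurable_fun setT f -> measurable_fun setT g ->
  measurable [set x | f x < g x].
Proof.
move=> mf mg; have := measurable_fun_ltr mf mg measurableT (I : measurable [set true]).
by rewrite setTI; exact.
Qed.

Lemma measurable_eq_set {d} {X : measurableType d} {R : realType} (f g : X -> R) :
  measurable_fun setT f -> measurable_fun setT g ->
  measurable [set x | f x = g x].
Proof.
move=> mf mg; have := measurable_fun_eqr mf mg measurableT (I : measurable [set true]).
rewrite setTI [X in measurable X -> _](_ : _ = [set x | f x = g x]); first exact.
by apply/seteqP; split => x /eqP.
Qed.

(** * Continuity of the mass of a varying set *)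

Section ae_stable.
Context {d : measure_display} {X : measurableType d} {R : realType}.
Variable nu : {measure set X -> \bar R}.
Hypothesis nu_fin : (nu setT < +oo)%E.
Context {T : pseudoMetricType R}.
Implicit Types (A B : T -> set X) (t : T).

(** The neighbourhood of [t] may depend on the point [x]: this is the almost everywhere convergence
    of indicators that dominated convergence asks for. *)
Definition ae_stable A t :=
  {ae nu, forall x, \forall s \near t, A s x <-> A t x}.

Lemma ae_stable_cst (A : set X) t : ae_stable (fun=> A) t.
Proof. by apply: nearW => x; exact: nearW. Qed.

Lemma ae_stableI A B t : ae_stable A t -> ae_stable B t ->
  ae_stable (fun s => A s `&` B s) t.
Proof.
apply: filterS2 => x; apply: filterS2 => s [AB BA] [CD DC].
by split=> -[? ?]; split; tauto.
Qed.

(** Off the null set where [f t] and [g t] agree, one of the two strict inequalities holds at [t],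
    and it persists for nearby parameters. *)
Lemma ae_stable_lt (f g : T -> X -> R) t :
  measurable_fun setT (f t) -> measurable_fun setT (g t) ->
  nu [set x | f t x = g t x] = 0%E ->
  (forall x, f s x @[s --> t] --> f t x) ->
  (forall x, g s x @[s --> t] --> g t x) ->
  ae_stable (fun s => [set x | f s x < g s x]) t.
Proof.
move=> mf mg fg0 cf cg.
have mE : measurable [set x | f t x = g t x].
  exact: measurable_eq_set.
exists [set x | f t x = g t x]; split => // x /=.
apply: contra_notP => /eqP/lt_total/orP[fgx|gfx0].
- have gf := fgx; rewrite -subr_gt0 in gf.
  apply: filterS (cvgr_gt _ (cvgB (cg x) (cf x)) _ gf) => s /=.
  by rewrite subr_gt0.
- have gf := gfx0; rewrite -subr_gt0 in gf.
  apply: filterS (cvgr_gt _ (cvgB (cf x) (cg x)) _ gf) => s /=.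
  rewrite subr_gt0 => gfs; split => h.
    by move: (lt_trans h gfs); rewrite ltxx.
  by move: (lt_trans h gfx0); rewrite ltxx.
Qed.

Lemma cvg_mass_stable A t : (forall s, measurable (A s)) -> ae_stable A t ->
  mass nu (A s) @[s --> t] --> mass nu (A t).
Proof.
move=> mA At; apply: (@cvg_sequentially _ _ (fun s => mass nu (A s))) => u ut.
by apply: cvg_mass => //; apply: filterS At => x; exact: ut.
Qed.

End ae_stable.

(** * Roots of decreasing functions depending on a parameter *)

Section monotone_root.
Context {R : realType}.

Lemma decreasing_root (g : R -> R) : continuous g ->
  (exists a, 0 < g a) -> (exists b, g b < 0) -> exists c, g c = 0.
Proof.
move=> cg [a a0] [b b0].
have cgw A : {within A, continuous g} by exact: continuous_subspaceT.
have [ab|/ltW ba] := leP a b.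
- have [|c _ gc] := IVT (v := 0) ab (cgw _); last by exists c.
  by rewrite ge_min le_max (ltW a0) (ltW b0) orbT.
- have [|c _ gc] := IVT (v := 0) ba (cgw _); last by exists c.
  by rewrite ge_min le_max (ltW a0) (ltW b0) orbT.
Qed.

(** The signs of [D] at the two fixed levels [r t - e] and [r t + e] persist near [t], and
    monotonicity traps the nearby roots between these levels. Continuity in the parameter at each
    fixed level thus suffices. *)
Lemma continuous_root {T : topologicalType} (D : T -> R -> R) (r : T -> R) :
  (forall t a b, a < b -> D t b < D t a) -> (forall t, D t (r t) = 0) ->
  (forall c, continuous (D^~ c)) -> continuous r.
Proof.
move=> dD rD cD t; apply/cvgrPdist_lt => e e0.
have hl : 0 < D t (r t - e) by rewrite -(rD t); apply: dD; lra.
have hr : D t (r t + e) < 0 by rewrite -(rD t); apply: dD; lra.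
apply: filterS2 (cvgr_gt _ (cD _ t) _ hl) (cvgr_lt _ (cD _ t) _ hr) => s sl sr.
have lt_root x : 0 < D s x -> x < r s.
  move=> Dx; rewrite ltNge le_eqVlt; apply/negP => /orP[/eqP rx|/dD rx].
    by move: Dx; rewrite -rx rD ltxx.
  by have := rx s; rewrite rD => /(lt_trans Dx); rewrite ltxx.
have gt_root x : D s x < 0 -> r s < x.
  move=> Dx; rewrite ltNge le_eqVlt; apply/negP => /orP[/eqP rx|/dD rx].
    by move: Dx; rewrite rx rD ltxx.
  by have := rx s; rewrite rD => /lt_trans/(_ Dx); rewrite ltxx.
by rewrite ltr_norml; apply/andP; split; move: (lt_root _ sl) (gt_root _ sr); lra.
Qed.

Lemma continuous_root_exists {T : topologicalType} (D : T -> R -> R) :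
  (forall t a b, a < b -> D t b < D t a) ->
  (forall t, continuous (D t)) -> (forall c, continuous (D^~ c)) ->
  (forall t, exists a, 0 < D t a) -> (forall t, exists a, D t a < 0) ->
  exists2 r : T -> R, continuous r & forall t, D t (r t) = 0.
Proof.
move=> dD cD cD' Dp Dn.
have /choice[r rP] : forall t, exists c, D t c = 0.
  by move=> t; exact: decreasing_root.
by exists r => //; exact: continuous_root rP cD'.
Qed.

End monotone_root.

(** * Existence, uniqueness and continuity of medians *)

Section median.
Context {d : measure_display} {X : measurableType d} {R : realType}.
Variable nu : {measure set X -> \bar R}.
Hypothesis nu_fin : (nu setT < +oo)%E.
Implicit Types (Q : set X) (f : X -> R).

(** The zeros in [c] are the medians of [f] on [Q]. *)
Definition bal Q f (c : R) : R :=
  mass nu (Q `&` [set x | c < f x]) - mass nu (Q `&` [set x | f x < c]).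

(** Null level sets make [bal] continuous in the level, and slabs of positive mass make it strictly
    decreasing; together they give exactly one median. *)
Definition cuttable Q f : Prop :=
  [/\ measurable Q, measurable_fun setT f,
      (forall c, nu [set x | f x = c] = 0%E) &
      (forall a b, a < b ->
        0 < mass nu (Q `&` ([set x | a < f x] `&` [set x | f x < b])))].

(* When [f] has several medians or none on [Q], this is a junk value. *)
Definition med Q f : R := get [set c | bal Q f c = 0].

Let mgt f c : measurable_fun setT f -> measurable [set x | c < f x].
Proof. by move=> mf; exact: measurable_lt_set. Qed.

Let mlt f c : measurable_fun setT f -> measurable [set x | f x < c].
Proof. by move=> mf; exact: measurable_lt_set. Qed.

Lemma balN Q f c : bal Q (\- f) (- c) = - bal Q f c.
Proof.
rewrite /bal opprB; congr (_ - _); congr (mass _ (_ `&` _));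
  by apply/seteqP; split => x /=; rewrite ltrN2.
Qed.

(** Raising the level adds the slab between [a] and [b], of positive mass, to the lower part, while
    the upper part can only shrink. *)
Lemma bal_decr Q f a b : cuttable Q f -> a < b -> bal Q f b < bal Q f a.
Proof.
move=> [mQ mf _ Qpos] ab; have mid := Qpos _ _ ab.
have mM : measurable (Q `&` ([set x | a < f x] `&` [set x | f x < b])).
  by apply: measurableI => //; apply: measurableI; [exact: mgt|exact: mlt].
have mA : measurable (Q `&` [set x | f x < a]) by apply: measurableI => //; exact: mlt.
have hr : mass nu (Q `&` [set x | b < f x]) <= mass nu (Q `&` [set x | a < f x]).
  apply: le_mass => //; try (by apply: measurableI => //; exact: mgt).
  by move=> x /= [Qx bf]; split => //; exact: lt_trans bf.
have hl : mass nu (Q `&` [set x | f x < a]) +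
    mass nu (Q `&` ([set x | a < f x] `&` [set x | f x < b])) <=
    mass nu (Q `&` [set x | f x < b]).
  rewrite -massU//.
    apply: le_mass => //; first exact: measurableU.
      by apply: measurableI => //; exact: mlt.
    by move=> x /= [[Qx fa]|[Qx [_ fb]]]; split => //; exact: lt_trans ab.
  apply/seteqP; split => // x /= [[_ fa] [_ [af _]]].
  by move: (lt_trans fa af); rewrite ltxx.
rewrite /bal; lra.
Qed.

Lemma cvg_bal {T : pseudoMetricType R} (Q : T -> set X) (f : T -> X -> R)
    (c : T -> R) (t : T) :
  (forall s, measurable (Q s)) -> ae_stable nu Q t ->
  (forall s, measurable_fun setT (f s)) ->
  (forall x, f s x @[s --> t] --> f t x) ->
  nu [set x | f t x = c t] = 0%E -> c s @[s --> t] --> c t ->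
  bal (Q s) (f s) (c s) @[s --> t] --> bal (Q t) (f t) (c t).
Proof.
move=> mQ sQ mf cf fc0 cc; apply: cvgB.
- apply: (cvg_mass_stable nu_fin (A := fun s => Q s `&` [set x | c s < f s x])).
    by move=> s; apply: measurableI => //; exact: mgt.
  apply: ae_stableI => //; apply: (@ae_stable_lt _ _ _ _ _ (fun s _ => c s)) => //.
  by rewrite -fc0; congr (nu _); apply/seteqP; split => x /=.
- apply: (cvg_mass_stable nu_fin (A := fun s => Q s `&` [set x | f s x < c s])).
    by move=> s; apply: measurableI => //; exact: mlt.
  by apply: ae_stableI => //; exact: (@ae_stable_lt _ _ _ _ _ _ (fun s _ => c s)).
Qed.

(** In the limit all of [Q] lies below the level, so [bal] tends to minus the mass of [Q]. Function
    and level both vary: moving levels yield medians, and moving slopes yield the extreme values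
    needed for intermediate value arguments. *)
Lemma bal_lt0_near Q (f_ : nat -> X -> R) (c_ : nat -> R) :
  measurable Q -> 0 < mass nu Q -> (forall n, measurable_fun setT (f_ n)) ->
  (forall x, Q x -> \forall n \near \oo, f_ n x < c_ n) ->
  exists n, bal Q (f_ n) (c_ n) < 0.
Proof.
move=> mQ Qpos mf fc.
have h1 : mass nu (Q `&` [set x | c_ n < f_ n x]) @[n --> \oo] --> mass nu set0.
  apply: cvg_mass => //.
    by move=> n; apply: measurableI => //; exact: mgt.
  apply: nearW => x; have [Qx|Qx] := pselect (Q x); last by apply: nearW => n; split => // -[].
  apply: filterS (fc x Qx) => n fcn; split => // -[_ /= cf].
  by move: (lt_trans fcn cf); rewrite ltxx.
have h2 : mass nu (Q `&` [set x | f_ n x < c_ n]) @[n --> \oo] --> mass nu Q.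
  apply: cvg_mass => //.
    by move=> n; apply: measurableI => //; exact: mlt.
  apply: nearW => x; have [Qx|Qx] := pselect (Q x); last first.
    by apply: nearW => n; split => // -[].
  by apply: filterS (fc x Qx) => n fcn; split => // -[].
have hQ : mass nu set0 - mass nu Q < 0 by rewrite mass_set0; lra.
by have [N _ /(_ N (leqnn N))] := cvgr_lt _ (cvgB h1 h2) _ hQ; exists N.
Qed.

Lemma bal_gt0_near Q (f_ : nat -> X -> R) (c_ : nat -> R) :
  measurable Q -> 0 < mass nu Q -> (forall n, measurable_fun setT (f_ n)) ->
  (forall x, Q x -> \forall n \near \oo, c_ n < f_ n x) ->
  exists n, 0 < bal Q (f_ n) (c_ n).
Proof.
move=> mQ Qpos mf fc.
have [|x Qx|n] := @bal_lt0_near Q (fun n => \- f_ n) (fun n => - c_ n) mQ Qpos.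
- by move=> n; exact: measurableT_comp.
- by apply: filterS (fc x Qx) => n; rewrite ltrN2.
- by rewrite balN oppr_lt0; exists n.
Qed.

Lemma cuttable_mass_gt0 Q f : cuttable Q f -> 0 < mass nu Q.
Proof.
move=> [mQ mf _ /(_ 0 1 ltr01)]; move/lt_le_trans; apply.
apply: le_mass => //; apply: measurableI => //; apply: measurableI.
- exact: mgt.
- exact: mlt.
Qed.

(** [bal] is continuous in the level and takes both signs along the levels [- n%:R] and [n%:R], so a
    median exists and [med] is not the junk value. *)
Lemma bal_med Q f : cuttable Q f -> bal Q f (med Q f) = 0.
Proof.
move=> Qf; have [mQ mf f0 _] := Qf; have Q0 := cuttable_mass_gt0 Qf.
apply: (@getPex _ [set c | bal Q f c = 0]); apply: decreasing_root.
- move=> c; apply: (@cvg_bal R (fun=> Q) (fun=> f) id) => //.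
  + exact: ae_stable_cst.
  + by move=> x; exact: cvg_cst.
- have [//|x _|n ?] := @bal_gt0_near Q (fun=> f) (fun n => - n%:R) mQ Q0.
    near=> n; rewrite ltrNl; near: n; exact: nbhs_infty_gtr.
  by exists (- n%:R).
- have [//|x _|n ?] := @bal_lt0_near Q (fun=> f) (fun n => n%:R) mQ Q0.
    exact: nbhs_infty_gtr.
  by exists n%:R.
Unshelve. all: by end_near. Qed.

Lemma med_gt Q f c : cuttable Q f -> 0 < bal Q f c -> c < med Q f.
Proof.
move=> Qf; have := bal_med Qf; have [|/(bal_decr Qf)|->] := ltgtP (med Q f) c => //.
  by move=> /(bal_decr Qf); lra.
by lra.
Qed.

Lemma med_lt Q f c : cuttable Q f -> bal Q f c < 0 -> med Q f < c.
Proof.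
move=> Qf; have := bal_med Qf; have [|/(bal_decr Qf)|->] := ltgtP (med Q f) c => //.
- by lra.
- by lra.
Qed.

Lemma med_unique Q f c : cuttable Q f -> bal Q f c = 0 -> c = med Q f.
Proof.
move=> Qf; have := bal_med Qf.
by have [/(bal_decr Qf)|/(bal_decr Qf)|->] := ltgtP (med Q f) c => //; lra.
Qed.

Lemma continuous_med {T : pseudoMetricType R} (Q : T -> set X) (f : T -> X -> R) :
  (forall t, cuttable (Q t) (f t)) -> (forall t, ae_stable nu Q t) ->
  (forall x, continuous (f^~ x)) -> continuous (fun t => med (Q t) (f t)).
Proof.
move=> Qf sQ cf; apply: (@continuous_root _ _ (fun t c => bal (Q t) (f t) c)).
- by move=> t a b; exact: bal_decr.
- by move=> t; exact: bal_med.
- move=> c t; apply: (@cvg_bal T Q f (fun=> c)) => //.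
  + by move=> s; case: (Qf s).
  + by move=> s; case: (Qf s).
  + by move=> x; exact: cf.
  + by case: (Qf t).
  + exact: cvg_cst.
Qed.

(** At the median [c] of [f], replacing [f] by [g] carries the points with [f x < c < g x] from
    below the level to above it, which makes [bal] positive. *)
Lemma ltr_med Q f g : cuttable Q f -> cuttable Q g ->
  (forall x, Q x -> f x <= g x) ->
  (forall c, 0 < mass nu (Q `&` ([set x | f x < c] `&` [set x | c < g x]))) ->
  med Q f < med Q g.
Proof.
move=> Qf Qg fg fcg; apply: med_gt => //.
have [mQ mf _ _] := Qf; have [_ mg _ _] := Qg.
have f0 := bal_med Qf; move: f0 (fcg (med Q f)); set c := med Q f => f0 pos.
have mM : measurable (Q `&` ([set x | f x < c] `&` [set x | c < g x])).
  by apply: measurableI => //; apply: measurableI; [exact: mlt|exact: mgt].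
have mA : measurable (Q `&` [set x | c < f x]) by apply: measurableI => //; exact: mgt.
have hl : mass nu (Q `&` [set x | g x < c]) <= mass nu (Q `&` [set x | f x < c]).
  apply: le_mass => //; try (by apply: measurableI => //; exact: mlt).
  by move=> x /= [Qx bf]; split => //; apply: le_lt_trans bf; exact: fg.
have hr : mass nu (Q `&` [set x | c < f x]) +
    mass nu (Q `&` ([set x | f x < c] `&` [set x | c < g x])) <=
    mass nu (Q `&` [set x | c < g x]).
  rewrite -massU//.
    apply: le_mass => //; first exact: measurableU.
      by apply: measurableI => //; exact: mgt.
    move=> x /= [[Qx fa]|[Qx [_ fb]]]; split => //.
    by apply: (lt_le_trans fa); exact: fg.
  apply/seteqP; split => // x /= [[_ fa] [_ [af _]]].
  by move: (lt_trans fa af); rewrite ltxx.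
by move: f0; rewrite /bal; lra.
Qed.

End median.

(** * Uniqueness and continuity of the equipartitions *)

Section planar_functionals.
Context {R : realType}.
Local Notation R3 := (R * R * R)%type.

Definition aff (a b c e : R) (x : R3) : R :=
  a * x.1.1 + b * x.1.2 + c * x.2 + e.

Lemma continuous_aff a b c e : continuous (aff a b c e).
Proof.
move=> x; have h1 : x0.1.1 @[x0 --> x] --> x.1.1.
  by apply: (@cvg_comp _ _ _ fst fst _ _ _ (@cvg_fst _ _ _ _ _)); exact: cvg_fst.
have h2 : x0.1.2 @[x0 --> x] --> x.1.2.
  by apply: (@cvg_comp _ _ _ fst snd _ _ _ (@cvg_fst _ _ _ _ _)); exact: cvg_snd.
have h3 : x0.2 @[x0 --> x] --> x.2 by exact: cvg_snd.
by rewrite /aff; apply: cvgD; [apply: cvgD; [apply: cvgD|]|];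
  try exact: cvg_cst; apply: cvgM => //; exact: cvg_cst.
Qed.

Lemma measurable_aff a b c e : measurable_fun setT (aff a b c e).
Proof.
have h1 : measurable_fun setT (fun x : R3 => x.1.1).
  exact: (measurableT_comp measurable_fst measurable_fst).
have h2 : measurable_fun setT (fun x : R3 => x.1.2).
  exact: (measurableT_comp measurable_snd measurable_fst).
have h3 : measurable_fun setT (fun x : R3 => x.2) by exact: measurable_snd.
by rewrite /aff; repeat apply: measurable_funD => //; exact: measurable_funM.
Qed.

(** Both functionals ignore the third coordinate, and the determinant makes their zero planes cross
    in a vertical line. *)
Definition indep (X Y : R3 -> R) := exists a b e a' b' e',
  [/\ a * b' - a' * b != 0, X = aff a b 0 e & Y = aff a' b' 0 e'].

(** By Cramer's rule, [k] and [l] times the determinant are combinations of the two horizontal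
    coefficients, so these cannot both vanish unless [k] and [l] do. *)
Lemma indep_comb X Y k l m e : indep X Y ->
  exists a b e', [/\ (fun x => k * X x + l * Y x + m * x.2 + e) = aff a b m e' &
    a = 0 -> b = 0 -> k = 0 /\ l = 0].
Proof.
move=> [a [b [u [a' [b' [u' [dt -> ->]]]]]]].
exists (k * a + l * a'), (k * b + l * b'), (k * u + l * u' + e); split.
  by apply/funext => x; rewrite /aff; ring.
move=> A B; split; apply/eqP; rewrite -(mulIr_eq0 _ (mulIf dt)); apply/eqP.
  have -> : k * (a * b' - a' * b) = b' * (k * a + l * a') - a' * (k * b + l * b') by ring.
  by rewrite A B; ring.
have -> : l * (a * b' - a' * b) = a * (k * b + l * b') - b * (k * a + l * a') by ring.
by rewrite A B; ring.
Qed.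

Lemma indep_surj X Y u w z : indep X Y -> exists x, [/\ X x = u, Y x = w & x.2 = z].
Proof.
move=> [a [b [e [a' [b' [e' [dt -> ->]]]]]]].
exists (((b' * (u - e) - b * (w - e')) / (a * b' - a' * b),
  (a * (w - e') - a' * (u - e)) / (a * b' - a' * b)), z).
by rewrite /aff; split => //=; field.
Qed.

Lemma indep_sym X Y : indep X Y -> indep Y X.
Proof.
move=> [a [b [e [a' [b' [e' [dt -> ->]]]]]]]; exists a', b', e', a, b, e.
by split => //; apply: contra dt => /eqP h; apply/eqP; lra.
Qed.

Lemma open_lt_fun {T : topologicalType} (f g : T -> R) :
  continuous f -> continuous g -> open [set x | f x < g x].
Proof.
move=> cf cg; rewrite (_ : [set _ | _] = (g \- f) @^-1` [set y | 0 < y]).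
  by apply: open_comp => [x _|]; [apply: cvgB; [exact: cg|exact: cf]|exact: open_gt].
by apply/seteqP; split => x /=; rewrite subr_gt0.
Qed.

End planar_functionals.

Section cuttable_functionals.
Context {R : realType}.
Local Notation R3 := (R * R * R)%type.
Variable nu : {measure set R3 -> \bar R}.
Hypothesis nu_fin : (nu setT < +oo)%E.
Hypothesis nu_plane : forall a b c e : R, [|| a != 0, b != 0 | c != 0] ->
  nu [set x | aff a b c e x = 0] = 0%E.
Hypothesis nu_open : forall U : set R3, open U -> measurable U -> U !=set0 ->
  0 < mass nu U.

(** Level sets are planes, hence null. A slab inside [Q] is open, and it contains a point because
    the functional takes every value on [Q]. *)
Lemma cuttable_aff (Q : set R3) a b c e : open Q -> measurable Q ->
  [|| a != 0, b != 0 | c != 0] ->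
  (forall u, exists2 x, Q x & aff a b c e x = u) -> cuttable nu Q (aff a b c e).
Proof.
move=> oQ mQ abc0 surj; split => //; first exact: measurable_aff.
  move=> u; rewrite -(nu_plane (e - u) abc0); congr (nu _).
  by apply/seteqP; split => x; rewrite /aff /= => h; lra.
move=> u v uv; apply: nu_open.
- apply: openI => //; apply: openI; apply: open_lt_fun;
    by [exact: continuous_aff|move=> ?; exact: cvg_cst].
- apply: measurableI => //; apply: measurableI; apply: measurable_lt_set => //;
    exact: measurable_aff.
- have [x Qx xuv] := surj ((u + v) / 2).
  by exists x; split => //; split; rewrite /= xuv; lra.
Qed.

Lemma ltr_med_aff (Q : set R3) a b c e a' b' c' e' : open Q -> measurable Q ->
  cuttable nu Q (aff a b c e) -> cuttable nu Q (aff a' b' c' e') ->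
  (forall x, Q x -> aff a b c e x <= aff a' b' c' e' x) ->
  (forall u, exists x, [/\ Q x, aff a b c e x < u & u < aff a' b' c' e' x]) ->
  med nu Q (aff a b c e) < med nu Q (aff a' b' c' e').
Proof.
move=> oQ mQ Qf Qg fg mid; apply: ltr_med => // u; apply: nu_open.
- apply: openI => //; apply: openI; apply: open_lt_fun;
    by [exact: continuous_aff|move=> ?; exact: cvg_cst].
- apply: measurableI => //; apply: measurableI; apply: measurable_lt_set => //;
    exact: measurable_aff.
- by have [x [Qx ? ?]] := mid u; exists x; split.
Qed.

End cuttable_functionals.

Section half_spaces.
Context {R : realType}.
Local Notation R3 := (R * R * R)%type.

(* The sign [e = 1] or [e = -1] selects one of the two sides of the plane [X = 0]. *)
Definition half (e : R) (X : R3 -> R) : set R3 := [set x | 0 < e * X x].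

Lemma indep_continuous (X Y : R3 -> R) : indep X Y -> continuous X.
Proof. by move=> [a [b [e [a' [b' [e' [_ -> _]]]]]]]; exact: continuous_aff. Qed.

Lemma indep_measurable (X Y : R3 -> R) : indep X Y -> measurable_fun setT X.
Proof. by move=> [a [b [e [a' [b' [e' [_ -> _]]]]]]]; exact: measurable_aff. Qed.

Lemma open_half e (X : R3 -> R) : continuous X -> open (half e X).
Proof.
move=> cX; apply: open_lt_fun => [x|x]; first exact: cvg_cst.
by apply: cvgM; [exact: cvg_cst|exact: cX].
Qed.

Lemma measurable_half e (X : R3 -> R) :
  measurable_fun setT X -> measurable (half e X).
Proof. by move=> mX; apply: measurable_lt_set => //; exact: measurable_funM. Qed.

End half_spaces.

(** * Halving both sides of a vertical plane by a second one *)

Section planar_partition.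
Context {R : realType}.
Local Notation R3 := (R * R * R)%type.
Variable nu : {measure set R3 -> \bar R}.
Hypothesis nu_fin : (nu setT < +oo)%E.
Hypothesis nu_plane : forall a b c e : R, [|| a != 0, b != 0 | c != 0] ->
  nu [set x | aff a b c e x = 0] = 0%E.
Hypothesis nu_open : forall U : set R3, open U -> measurable U -> U !=set0 ->
  0 < mass nu U.
Implicit Types X Y W : R3 -> R.

Lemma indep_null X Y : indep X Y -> nu [set x | X x = 0] = 0%E.
Proof.
move=> [a [b [e [a' [b' [e' [dt -> _]]]]]]]; apply: nu_plane.
have [a0|//] := eqVneq a 0; have [b0|//] := eqVneq b 0.
by move: dt; rewrite a0 b0 mul0r mulr0 subrr eqxx.
Qed.

Lemma half_stable {T : pseudoMetricType R} e (X : T -> R3 -> R) (Y : T -> R3 -> R) t :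
  e * e = 1 -> (forall t, indep (X t) (Y t)) -> (forall x, continuous (X^~ x)) ->
  ae_stable nu (fun t => half e (X t)) t.
Proof.
move=> ee XY cX.
apply: (@ae_stable_lt _ _ _ _ _ (fun _ _ => 0) (fun t x => e * X t x)) => //.
- by apply: measurable_funM => //; exact: indep_measurable (XY t).
- rewrite -(indep_null (XY t)); congr (nu _); apply/seteqP; split => x /=.
    by move=> h; rewrite -[X t x]mul1r -ee -mulrA -h mulr0.
  by move=> ->; rewrite mulr0.
- by move=> x; exact: cvg_cst.
- by move=> x; apply: cvgM; [exact: cvg_cst|exact: cX].
Qed.

Lemma comb_aff X W al : indep X W -> exists a b e,
  (fun x => W x - al * X x) = aff a b 0 e /\ [|| a != 0, b != 0 | (0 : R) != 0].
Proof.
move=> /(@indep_comb _ _ _ (- al) 1 0 0) [a [b [e [E nz]]]].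
exists a, b, e; split; first by rewrite -E; apply/funext => x; ring.
have [a0|//] := eqVneq a 0; have [b0|//] := eqVneq b 0.
by have [_ /eqP] := nz a0 b0; rewrite oner_eq0.
Qed.

Lemma cuttable_half X W e al : indep X W -> e * e = 1 ->
  cuttable nu (half e X) (fun x => W x - al * X x).
Proof.
move=> XW ee; have [a [b [e' [E nz]]]] := comb_aff al XW; rewrite E.
apply: cuttable_aff => //.
- by apply: open_half; exact: indep_continuous XW.
- by apply: measurable_half; exact: indep_measurable XW.
- move=> u; have [x [xX xW _]] := indep_surj e (u + al * e) 0 XW.
  exists x; first by rewrite /half/= xX ee ltr01.
  by rewrite -E /= xX xW; ring.
Qed.

(** The two functionals differ by [(al' - al) * X x], which is positive on the side [e]. *)
Lemma med_half_decr X W e al al' : indep X W -> e * e = 1 -> 0 < e * (al' - al) ->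
  med nu (half e X) (fun x => W x - al' * X x) <
  med nu (half e X) (fun x => W x - al * X x).
Proof.
move=> XW ee aa; have := cuttable_half al XW ee; have := cuttable_half al' XW ee.
have [a [b [c [E _]]]] := comb_aff al XW.
have [a' [b' [c' [E' _]]]] := comb_aff al' XW.
rewrite E E' => C' C; apply: ltr_med_aff => //.
- by apply: open_half; exact: indep_continuous XW.
- by apply: measurable_half; exact: indep_measurable XW.
- move=> x xQ; rewrite -E -E' /= -subr_ge0.
  have -> : W x - al * X x - (W x - al' * X x) = (e * e) * ((al' - al) * X x).
    by rewrite ee; ring.
  by rewrite mulrACA ltW// mulr_gt0.
(* At this point, with [X x = e], the values of the two functionals are symmetric about [u]. *)
- move=> u; have [x [xX xW _]] := indep_surj e (u + (al + al') * e / 2) 0 XW.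
  exists x; rewrite /half/= -E -E' /= xX xW ee; split => //.
    rewrite -subr_gt0 (_ : _ - _ = e * (al' - al) / 2); last by field.
    by rewrite divr_gt0.
  rewrite -subr_gt0 (_ : _ - _ = e * (al' - al) / 2); last by field.
  by rewrite divr_gt0.
Qed.

(** Since [e * X x] is positive on the side [e], the functional tends to infinity with [n] at each
    of its points, so the median passes any bound [K]. *)
Lemma med_half_big X W e K : indep X W -> e * e = 1 ->
  exists n : nat, K < med nu (half e X) (fun x => W x - - (e * n%:R) * X x).
Proof.
move=> XW ee; have C n := cuttable_half (- (e * n%:R)) XW ee.
have [mQ _ _ _] := C 0%N.
have [||x xQ|n] := bal_gt0_near (f_ := fun n x => W x - - (e * n%:R) * X x)
    (c_ := fun=> K) nu_fin mQ.
- exact: cuttable_mass_gt0 (C 0%N).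
- by move=> n; case: (C n).
- near=> n; rewrite mulNr opprK -mulrA mulrCA addrC -ltrBlDr -ltr_pdivrMr//.
  by near: n; exact: nbhs_infty_gtr.
- by move=> n0; exists n; exact: med_gt.
Unshelve. all: by end_near. Qed.

Lemma med_half_small X W e K : indep X W -> e * e = 1 ->
  exists n : nat, med nu (half e X) (fun x => W x - (e * n%:R) * X x) < K.
Proof.
move=> XW ee; have C n := cuttable_half (e * n%:R) XW ee.
have [mQ _ _ _] := C 0%N.
have [||x xQ|n] := bal_lt0_near (f_ := fun n x => W x - (e * n%:R) * X x)
    (c_ := fun=> K) nu_fin mQ.
- exact: cuttable_mass_gt0 (C 0%N).
- by move=> n; case: (C n).
- near=> n; rewrite -mulrA mulrCA ltrBlDr -ltrBlDl -ltr_pdivrMr//.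
  by near: n; exact: nbhs_infty_gtr.
- by move=> n0; exists n; exact: med_lt.
Unshelve. all: by end_near. Qed.

Lemma continuous_med_half {T : pseudoMetricType R} e (X W : T -> R3 -> R) (al : T -> R) :
  e * e = 1 -> (forall t, indep (X t) (W t)) -> (forall x, continuous (X^~ x)) ->
  (forall x, continuous (W^~ x)) -> continuous al ->
  continuous (fun t => med nu (half e (X t)) (fun x => W t x - al t * X t x)).
Proof.
move=> ee XW cX cW cal; apply: continuous_med => //.
- by move=> t; exact: cuttable_half.
- by move=> t; exact: half_stable XW cX.
- move=> x t; apply: cvgB; first exact: cW.
  by apply: cvgM; [exact: cal|exact: cX].
Qed.

Let one2 : (1 : R) * 1 = 1. Proof. by rewrite mulr1. Qed.
Let mone2 : (-1 : R) * -1 = 1. Proof. by rewrite mulrNN mulr1. Qed.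

(* The slope of the line halving both sides of [X = 0] is the zero of the
   difference of the two medians, which is decreasing. *)
Lemma halving_line_exists {T : pseudoMetricType R} (X W : T -> R3 -> R) :
  (forall t, indep (X t) (W t)) -> (forall x, continuous (X^~ x)) ->
  (forall x, continuous (W^~ x)) ->
  exists al be : T -> R, [/\ continuous al, continuous be & forall t e, e * e = 1 ->
    bal nu (half e (X t)) (fun x => W t x - al t * X t x) (be t) = 0].
Proof.
move=> XW cX cW.
pose m e t a := med nu (half e (X t)) (fun x => W t x - a * X t x).
have m1 t a b : a < b -> m 1 t b < m 1 t a.
  by move=> ab; apply: med_half_decr => //; lra.
have mN1 t a b : a < b -> m (-1) t a < m (-1) t b.
  by move=> ab; apply: med_half_decr => //; lra.
have [|||t|t|al cal Dal] := @continuous_root_exists R T (fun t a => m 1 t a - m (-1) t a).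
- by move=> t a b ab; have := m1 t _ _ ab; have := mN1 t _ _ ab; lra.
- move=> t a; apply: cvgB.
    by apply: (@continuous_med_half R 1 (fun=> X t) (fun=> W t) id) => // [x|x|];
      [exact: cst_continuous|exact: cst_continuous|move=> y; exact: cvg_id].
  by apply: (@continuous_med_half R (-1) (fun=> X t) (fun=> W t) id) => // [x|x|];
    [exact: cst_continuous|exact: cst_continuous|move=> y; exact: cvg_id].
- move=> a t; apply: cvgB.
    by apply: (@continuous_med_half T 1 X W (fun=> a)) => // y; exact: cvg_cst.
  by apply: (@continuous_med_half T (-1) X W (fun=> a)) => // y; exact: cvg_cst.
(* Lowering the slope lowers the median on the negative side, so its value at slope 0 is a bound
   independent of [n], to be exceeded on the positive side. *)
- have [n] := med_half_big (m (-1) t 0) (XW t) one2; rewrite mul1r => hn.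
  exists (- n%:R); rewrite subr_gt0; apply: le_lt_trans hn.
  case: n => [|n]; first by rewrite oppr0.
  by apply/ltW/mN1; rewrite oppr_lt0.
- have [n] := med_half_small (m (-1) t 0) (XW t) one2; rewrite mul1r => hn.
  exists n%:R; rewrite subr_lt0; apply: (lt_le_trans hn).
  by case: n {hn} => [//|n]; apply/ltW/mN1.
exists al, (fun t => m 1 t (al t)); split => //.
  exact: continuous_med_half.
move=> t e ee; rewrite [X in bal _ _ _ X](_ : _ = m e t (al t)).
  by apply: bal_med => //; exact: cuttable_half.
have /eqP : (e - 1) * (e + 1) = 0 by rewrite mulrDr mulrBl ee; ring.
rewrite mulf_eq0 subr_eq0 addr_eq0 => /orP[/eqP ->//|/eqP ->].
by apply/eqP; rewrite -subr_eq0 Dal.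
Qed.

(** A change of slope moves the medians on the two sides in opposite directions, so they coincide
    for at most one slope. *)
Lemma halving_line_unique X W al be al' be' : indep X W ->
  (forall e, e * e = 1 -> bal nu (half e X) (fun x => W x - al * X x) be = 0) ->
  (forall e, e * e = 1 -> bal nu (half e X) (fun x => W x - al' * X x) be' = 0) ->
  al = al' /\ be = be'.
Proof.
move=> XW H H'.
have M e (ee : e * e = 1) : be = med nu (half e X) (fun x => W x - al * X x) /\
    be' = med nu (half e X) (fun x => W x - al' * X x).
  split; (apply: med_unique; [by []|exact: cuttable_half|]); [exact: H|exact: H'].
have [b1 b1'] := M _ one2; have [b2 b2'] := M _ mone2.
suff aa : al = al' by split => //; rewrite b1 b1' aa.
case: (ltgtP al al') => // aa.
- have h1 : med nu (half 1 X) (fun x => W x - al' * X x) <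
      med nu (half 1 X) (fun x => W x - al * X x) by apply: med_half_decr => //; lra.
  have h2 : med nu (half (-1) X) (fun x => W x - al * X x) <
      med nu (half (-1) X) (fun x => W x - al' * X x) by apply: med_half_decr => //; lra.
  by lra.
- have h1 : med nu (half 1 X) (fun x => W x - al * X x) <
      med nu (half 1 X) (fun x => W x - al' * X x) by apply: med_half_decr => //; lra.
  have h2 : med nu (half (-1) X) (fun x => W x - al' * X x) <
      med nu (half (-1) X) (fun x => W x - al * X x) by apply: med_half_decr => //; lra.
  by lra.
Qed.

End planar_partition.

(** * Slopes that balance the medians on the four wedges *)

Section spatial_partition.
Context {R : realType}.
Local Notation R3 := (R * R * R)%type.
Variable nu : {measure set R3 -> \bar R}.
Hypothesis nu_fin : (nu setT < +oo)%E.
Hypothesis nu_plane : forall a b c e : R, [|| a != 0, b != 0 | c != 0] ->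
  nu [set x | aff a b c e x = 0] = 0%E.
Hypothesis nu_open : forall U : set R3, open U -> measurable U -> U !=set0 ->
  0 < mass nu U.
Implicit Types X Y : R3 -> R.

Definition wedge (e1 e2 : R) X Y : set R3 := half e1 X `&` half e2 Y.

Definition height (a b : R) X Y : R3 -> R := fun x => x.2 - a * X x - b * Y x.

Lemma height_aff X Y a b : indep X Y -> exists k l e,
  height a b X Y = aff k l 1 e /\ [|| k != 0, l != 0 | (1 : R) != 0].
Proof.
move=> /(@indep_comb _ _ _ (- a) (- b) 1 0) [k [l [e [E nz]]]].
exists k, l, e; split; last by rewrite oner_eq0 !orbT.
by rewrite -E /height; apply/funext => x; ring.
Qed.

Lemma open_wedge X Y e1 e2 : indep X Y -> open (wedge e1 e2 X Y).
Proof.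
move=> XY; apply: openI; apply: open_half; first exact: indep_continuous XY.
exact: indep_continuous (indep_sym XY).
Qed.

Lemma measurable_wedge X Y e1 e2 : indep X Y -> measurable (wedge e1 e2 X Y).
Proof.
move=> XY; apply: measurableI; apply: measurable_half.
  exact: indep_measurable XY.
exact: indep_measurable (indep_sym XY).
Qed.

Lemma cuttable_wedge X Y e1 e2 a b : indep X Y -> e1 * e1 = 1 -> e2 * e2 = 1 ->
  cuttable nu (wedge e1 e2 X Y) (height a b X Y).
Proof.
move=> XY ee1 ee2; have [k [l [c [E nz]]]] := height_aff a b XY; rewrite E.
apply: cuttable_aff => //.
- exact: open_wedge.
- exact: measurable_wedge.
- move=> u; have [x [xX xY xZ]] := indep_surj e1 e2 (u + a * e1 + b * e2) XY.
  exists x; first by split; rewrite /half/= ?xX ?xY ?ee1 ?ee2 ltr01.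
  by rewrite -E /height xX xY xZ; ring.
Qed.

(** On the wedge both terms of the difference [(a' - a) * X x + (b' - b) * Y x] are non-negative.
    Strictness is asked of the sum only, so that one slope may stay fixed. *)
Lemma med_wedge_decr X Y e1 e2 a b a' b' : indep X Y -> e1 * e1 = 1 -> e2 * e2 = 1 ->
  0 <= e1 * (a' - a) -> 0 <= e2 * (b' - b) -> 0 < e1 * (a' - a) + e2 * (b' - b) ->
  med nu (wedge e1 e2 X Y) (height a' b' X Y) <
  med nu (wedge e1 e2 X Y) (height a b X Y).
Proof.
move=> XY ee1 ee2 aa bb ab.
have := cuttable_wedge a b XY ee1 ee2; have := cuttable_wedge a' b' XY ee1 ee2.
have [k [l [c [E _]]]] := height_aff a b XY.
have [k' [l' [c' [E' _]]]] := height_aff a' b' XY.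
rewrite E E' => C' C; apply: ltr_med_aff => //.
- exact: open_wedge.
- exact: measurable_wedge.
- move=> x [xX xY]; rewrite -E -E' /height -subr_ge0.
  have -> : x.2 - a * X x - b * Y x - (x.2 - a' * X x - b' * Y x) =
      (e1 * e1) * ((a' - a) * X x) + (e2 * e2) * ((b' - b) * Y x).
    by rewrite ee1 ee2; ring.
  by rewrite mulrACA [X in _ + X]mulrACA addr_ge0// mulr_ge0// ltW.
- move=> u; have [x [xX xY xZ]] :=
    indep_surj e1 e2 (u + ((a + a') * e1 + (b + b') * e2) / 2) XY.
  exists x; rewrite -E -E' /height xX xY xZ; split.
  + by split; rewrite /half/= ?xX ?xY ?ee1 ?ee2 ltr01.
  + rewrite -subr_gt0 (_ : _ - _ = (e1 * (a' - a) + e2 * (b' - b)) / 2); last by field.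
    by rewrite divr_gt0.
  + rewrite -subr_gt0 (_ : _ - _ = (e1 * (a' - a) + e2 * (b' - b)) / 2); last by field.
    by rewrite divr_gt0.
Qed.

Lemma height_swap X Y a b : height a b X Y = height b a Y X.
Proof. by apply/funext => x; rewrite /height; ring. Qed.

Lemma wedge_swap X Y e1 e2 : wedge e1 e2 X Y = wedge e2 e1 Y X.
Proof. exact: setIC. Qed.

Lemma med_wedge_big X Y e1 e2 a K : indep X Y -> e1 * e1 = 1 -> e2 * e2 = 1 ->
  exists n : nat, K < med nu (wedge e1 e2 X Y) (height a (- (e2 * n%:R)) X Y).
Proof.
move=> XY ee1 ee2; have C n := cuttable_wedge a (- (e2 * n%:R)) XY ee1 ee2.
have [mQ _ _ _] := C 0%N.
have [||x [xX xY]|n] := bal_gt0_near (f_ := fun n => height a (- (e2 * n%:R)) X Y)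
    (c_ := fun=> K) nu_fin mQ.
- exact: cuttable_mass_gt0 (C 0%N).
- by move=> n; case: (C n).
- near=> n.
  rewrite /height mulNr opprK -mulrA mulrCA addrC -ltrBlDr -ltr_pdivrMr//.
  by near: n; exact: nbhs_infty_gtr.
- by move=> n0; exists n; exact: med_gt.
Unshelve. all: by end_near. Qed.

Lemma med_wedge_small X Y e1 e2 a K : indep X Y -> e1 * e1 = 1 -> e2 * e2 = 1 ->
  exists n : nat, med nu (wedge e1 e2 X Y) (height a (e2 * n%:R) X Y) < K.
Proof.
move=> XY ee1 ee2; have C n := cuttable_wedge a (e2 * n%:R) XY ee1 ee2.
have [mQ _ _ _] := C 0%N.
have [||x [xX xY]|n] := bal_lt0_near (f_ := fun n => height a (e2 * n%:R) X Y)
    (c_ := fun=> K) nu_fin mQ.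
- exact: cuttable_mass_gt0 (C 0%N).
- by move=> n; case: (C n).
- near=> n; rewrite /height -mulrA mulrCA ltrBlDr -ltrBlDl -ltr_pdivrMr//.
  by near: n; exact: nbhs_infty_gtr.
- by move=> n0; exists n; exact: med_lt.
Unshelve. all: by end_near. Qed.

Lemma continuous_med_wedge {T : pseudoMetricType R} e1 e2 (X Y : T -> R3 -> R)
    (a b : T -> R) : e1 * e1 = 1 -> e2 * e2 = 1 ->
  (forall t, indep (X t) (Y t)) -> (forall x, continuous (X^~ x)) ->
  (forall x, continuous (Y^~ x)) -> continuous a -> continuous b ->
  continuous (fun t => med nu (wedge e1 e2 (X t) (Y t)) (height (a t) (b t) (X t) (Y t))).
Proof.
move=> ee1 ee2 XY cX cY ca cb; apply: continuous_med => //.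
- by move=> t; exact: cuttable_wedge.
- move=> t; apply: ae_stableI; first exact: half_stable XY cX.
  by apply: half_stable cY => // s; exact: (indep_sym (XY s)).
- move=> x t; rewrite /height; apply: cvgB; [apply: cvgB; first exact: cvg_cst|].
    by apply: cvgM; [exact: ca|exact: cX].
  by apply: cvgM; [exact: cb|exact: cY].
Qed.

Let one2 : (1 : R) * 1 = 1. Proof. by rewrite mulr1. Qed.
Let mone2 : (-1 : R) * -1 = 1. Proof. by rewrite mulrNN mulr1. Qed.

Local Notation m e1 e2 X Y a b := (med nu (wedge e1 e2 X Y) (height a b X Y)).

Lemma med_diag_decr X Y a b a' b' : indep X Y -> a <= a' -> b <= b' ->
  a + b < a' + b' ->
  m 1 1 X Y a' b' - m (-1) (-1) X Y a' b' < m 1 1 X Y a b - m (-1) (-1) X Y a b.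
Proof.
move=> XY aa bb ab.
have h1 : m 1 1 X Y a' b' < m 1 1 X Y a b by apply: med_wedge_decr => //; lra.
have h2 : m (-1) (-1) X Y a b < m (-1) (-1) X Y a' b'.
  by apply: med_wedge_decr => //; lra.
by lra.
Qed.

Lemma med_antidiag_decr X Y a b a' b' : indep X Y -> a <= a' -> b' <= b ->
  a - b < a' - b' ->
  m 1 (-1) X Y a' b' - m (-1) 1 X Y a' b' < m 1 (-1) X Y a b - m (-1) 1 X Y a b.
Proof.
move=> XY aa bb ab.
have h1 : m 1 (-1) X Y a' b' < m 1 (-1) X Y a b by apply: med_wedge_decr => //; lra.
have h2 : m (-1) 1 X Y a b < m (-1) 1 X Y a' b' by apply: med_wedge_decr => //; lra.
by lra.
Qed.

(** The inner root [be (t, a)] balances the diagonal wedges; using the pair as parameter makes it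
    jointly continuous. It decreases in [a], so along it the antidiagonal difference is strictly
    decreasing too, and its root is [al]. *)
Lemma balanced_slopes_exist {T : pseudoMetricType R} (X Y : T -> R3 -> R) :
  (forall t, indep (X t) (Y t)) -> (forall x, continuous (X^~ x)) ->
  (forall x, continuous (Y^~ x)) ->
  exists a b : T -> R, [/\ continuous a, continuous b &
    forall t, m 1 1 (X t) (Y t) (a t) (b t) = m (-1) (-1) (X t) (Y t) (a t) (b t) /\
      m 1 (-1) (X t) (Y t) (a t) (b t) = m (-1) 1 (X t) (Y t) (a t) (b t)].
Proof.
move=> XY cX cY.
pose D (ta : T * R) b := m 1 1 (X ta.1) (Y ta.1) ta.2 b -
  m (-1) (-1) (X ta.1) (Y ta.1) ta.2 b.
have cX1 x : continuous (fun ta : T * R => X ta.1 x).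
  by move=> ta; apply: (@continuous_comp _ _ _ fst (X^~ x)); [exact: cvg_fst|exact: cX].
have cY1 x : continuous (fun ta : T * R => Y ta.1 x).
  by move=> ta; apply: (@continuous_comp _ _ _ fst (Y^~ x)); [exact: cvg_fst|exact: cY].
have c2 : continuous (fun ta : T * R => ta.2) by move=> ta; exact: cvg_snd.
have cstX (t : T) (x : R3) : continuous (fun _ : R => X t x) by exact: cst_continuous.
have cstY (t : T) (x : R3) : continuous (fun _ : R => Y t x) by exact: cst_continuous.
have cid : continuous (fun a : R => a) by move=> ?; exact: cvg_id.
have [|ta|b|ta|ta|be cbe Dbe] := @continuous_root_exists R (T * R)%type D.
- by move=> ta b b' bb; apply: med_diag_decr => //; lra.
- move=> b; apply: cvgB.
    by apply: (@continuous_med_wedge R 1 1 (fun=> X ta.1) (fun=> Y ta.1) (fun=> ta.2) id)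
      => //; exact: cst_continuous.
  by apply: (@continuous_med_wedge R (-1) (-1) (fun=> X ta.1) (fun=> Y ta.1)
    (fun=> ta.2) id) => //; exact: cst_continuous.
- move=> ta; apply: cvgB.
    by apply: (@continuous_med_wedge _ 1 1 (fun ta => X ta.1) (fun ta => Y ta.1)
      (fun ta => ta.2) (fun=> b)) => //; exact: cst_continuous.
  by apply: (@continuous_med_wedge _ (-1) (-1) (fun ta => X ta.1) (fun ta => Y ta.1)
    (fun ta => ta.2) (fun=> b)) => //; exact: cst_continuous.
- have [n] := med_wedge_big ta.2 (m (-1) (-1) (X ta.1) (Y ta.1) ta.2 0) (XY ta.1) one2 one2.
  rewrite mul1r => hn; exists (- n%:R); rewrite subr_gt0; apply: le_lt_trans hn.
  case: n => [|n]; first by rewrite oppr0.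
  by apply/ltW/med_wedge_decr => //; have := ltr0Sn R n; lra.
- have [n] := med_wedge_small ta.2 (m (-1) (-1) (X ta.1) (Y ta.1) ta.2 0) (XY ta.1) one2 one2.
  rewrite mul1r => hn; exists n%:R; rewrite subr_lt0; apply: (lt_le_trans hn).
  case: n {hn} => [//|n].
  by apply/ltW/med_wedge_decr => //; have := ltr0Sn R n; lra.
(* Otherwise neither slope would decrease, and [D] would drop strictly between two of its zeros. *)
have be_decr t a a' : a < a' -> be (t, a') < be (t, a).
  move=> aa; rewrite ltNge; apply/negP => bb.
  have : D (t, a') (be (t, a')) < D (t, a) (be (t, a)).
    by apply: med_diag_decr => //=; lra.
  by rewrite !Dbe ltxx.
pose E t a := m 1 (-1) (X t) (Y t) a (be (t, a)) - m (-1) 1 (X t) (Y t) a (be (t, a)).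
have cbe1 a : continuous (fun t => be (t, a)).
  move=> t; apply: (@continuous_comp _ _ _ (fun t => (t, a)) be); last exact: cbe.
  exact: (cvg_pair (@cvg_id _ (nbhs t)) (@cvg_cst _ a _ (nbhs t) _)).
have cbe2 t : continuous (fun a => be (t, a)).
  move=> a; apply: (@continuous_comp _ _ _ (fun a => (t, a)) be); last exact: cbe.
  exact: (cvg_pair (@cvg_cst _ t _ (nbhs a) _) (@cvg_id _ (nbhs a))).
have [|t|a|t|t|al cal Eal] := @continuous_root_exists R T E.
- move=> t a a' aa; have bb := be_decr t _ _ aa.
  by apply: med_antidiag_decr => //; lra.
- move=> a; apply: cvgB.
    by apply: (@continuous_med_wedge R 1 (-1) (fun=> X t) (fun=> Y t) id
      (fun a => be (t, a))).
  by apply: (@continuous_med_wedge R (-1) 1 (fun=> X t) (fun=> Y t) id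
      (fun a => be (t, a))).
- move=> t; apply: cvgB.
    by apply: (@continuous_med_wedge T 1 (-1) X Y (fun=> a) (fun t => be (t, a)))
      => //; exact: cst_continuous.
  by apply: (@continuous_med_wedge T (-1) 1 X Y (fun=> a) (fun t => be (t, a)))
      => //; exact: cst_continuous.
(* The growth estimate varies the second slope, so the lines are exchanged in order to vary [a]. It
   is applied with the other slope frozen at [be (t, 0)]; the true value [be (t, - n%:R)] is no
   smaller, which shifts both medians the right way. *)
- have [n] := med_wedge_big (be (t, 0)) (m (-1) 1 (X t) (Y t) 0 (be (t, 0)))
    (indep_sym (XY t)) mone2 one2.
  rewrite [wedge _ _ (Y t) _]wedge_swap [height _ _ (Y t) _]height_swap mul1r => hn; exists (- n%:R).
  rewrite subr_gt0; case: n hn => [|n hn]; first by rewrite oppr0.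
  have n0 : - n.+1%:R < 0 :> R by rewrite oppr_lt0.
  have bb := be_decr t _ _ n0.
  apply: lt_trans (lt_trans hn _); apply: med_wedge_decr => //; lra.
- have [n] := med_wedge_small (be (t, 0)) (m (-1) 1 (X t) (Y t) 0 (be (t, 0)))
    (indep_sym (XY t)) mone2 one2.
  rewrite [wedge _ _ (Y t) _]wedge_swap [height _ _ (Y t) _]height_swap mul1r => hn; exists n%:R.
  rewrite subr_lt0; case: n hn => [//|n hn].
  have n0 : 0 < n.+1%:R :> R by [].
  have bb := be_decr t _ _ n0.
  apply: lt_trans (lt_trans hn _); apply: med_wedge_decr => //; lra.
exists al, (fun t => be (t, al t)); split => //.
  move=> t; apply: (@continuous_comp _ _ _ (fun t => (t, al t)) be); last exact: cbe.
  exact: (cvg_pair (@cvg_id _ (nbhs t)) (cal t)).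
move=> t; split; apply/eqP; rewrite -subr_eq0; apply/eqP.
- exact: (Dbe (t, al t)).
- exact: Eal.
Qed.

(* [c] is the common median on the wedges with [e1 = e2] and [k] the one on the
   wedges with [e1 = - e2]; the plane [height a b X Y = c] halves all four wedges
   when [c = k]. *)
Definition balanced X Y (a b c k : R) : Prop := forall e1 e2, e1 * e1 = 1 ->
  e2 * e2 = 1 -> bal nu (wedge e1 e2 X Y) (height a b X Y) (if e1 == e2 then c else k) = 0.

Lemma sqr_eq1 (e : R) : e * e = 1 -> e = 1 \/ e = -1.
Proof.
move=> ee; have /eqP : (e - 1) * (e + 1) = 0 by rewrite mulrDr mulrBl ee; ring.
by rewrite mulf_eq0 subr_eq0 addr_eq0 => /orP[/eqP ->|/eqP ->]; [left|right].
Qed.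

Lemma balanced_exists {T : pseudoMetricType R} (X Y : T -> R3 -> R) :
  (forall t, indep (X t) (Y t)) -> (forall x, continuous (X^~ x)) ->
  (forall x, continuous (Y^~ x)) ->
  exists a b c k : T -> R, [/\ continuous c, continuous k &
    forall t, balanced (X t) (Y t) (a t) (b t) (c t) (k t)].
Proof.
move=> XY cX cY; have [a [b [ca cb ab]]] := balanced_slopes_exist XY cX cY.
exists a, b, (fun t => m 1 1 (X t) (Y t) (a t) (b t)),
  (fun t => m 1 (-1) (X t) (Y t) (a t) (b t)); split.
- exact: continuous_med_wedge.
- exact: continuous_med_wedge.
- move=> t e1 e2 ee1 ee2; have [ab1 ab2] := ab t.
  rewrite [X in bal _ _ _ X](_ : _ = m e1 e2 (X t) (Y t) (a t) (b t)).
    by apply: bal_med => //; exact: cuttable_wedge.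
  have n1 : (1 == -1 :> R) = false by apply/eqP; lra.
  have n2 : (-1 == 1 :> R) = false by apply/eqP; lra.
  by case: (sqr_eq1 ee1) => ->; case: (sqr_eq1 ee2) => ->; rewrite ?eqxx ?n1 ?n2.
Qed.

(** If [a] and [b] move the same way the diagonal difference changes strictly, and if they move
    opposite ways the antidiagonal one does; both vanish for balanced slopes, so the slopes
    agree. *)
Lemma balanced_unique X Y a b c k a' b' c' k' : indep X Y ->
  balanced X Y a b c k -> balanced X Y a' b' c' k' -> c = c' /\ k = k'.
Proof.
move=> XY H H'.
have M e1 e2 (ee1 : e1 * e1 = 1) (ee2 : e2 * e2 = 1) :
    (if e1 == e2 then c else k) = m e1 e2 X Y a b /\
    (if e1 == e2 then c' else k') = m e1 e2 X Y a' b'.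
  split; (apply: med_unique; [by []|exact: cuttable_wedge|]); [exact: H|exact: H'].
have n1 : (1 == -1 :> R) = false by apply/eqP; lra.
have n2 : (-1 == 1 :> R) = false by apply/eqP; lra.
have [p1 p1'] := M _ _ one2 one2; have [q1 q1'] := M _ _ one2 mone2.
have [r1 r1'] := M _ _ mone2 one2; have [s1 s1'] := M _ _ mone2 mone2.
rewrite !eqxx ?n1 ?n2 in p1 p1' q1 q1' r1 r1' s1 s1'.
suff [aa bb] : a = a' /\ b = b' by rewrite p1 p1' q1 q1' aa bb.
(* Two different pairs of slopes are comparable lexicographically, so excluding this order in both
   directions suffices. *)
have lt_absurd a1 b1 a2 b2 : m 1 1 X Y a1 b1 = m (-1) (-1) X Y a1 b1 ->
    m 1 (-1) X Y a1 b1 = m (-1) 1 X Y a1 b1 ->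
    m 1 1 X Y a2 b2 = m (-1) (-1) X Y a2 b2 ->
    m 1 (-1) X Y a2 b2 = m (-1) 1 X Y a2 b2 -> a1 < a2 \/ a1 = a2 /\ b1 < b2 -> False.
  move=> d1 g1 d2 g2 ab; have aa : a1 <= a2 by case: ab => [/ltW|[->]].
  have [bb|bb] := leP b1 b2.
    have ab' : a1 + b1 < a2 + b2.
      by case: ab => [ab|[-> ?]]; [exact: ltr_leD|rewrite ltrD2l].
    by have := med_diag_decr XY aa bb ab'; rewrite d1 d2 !subrr ltxx.
  have ab' : a1 - b1 < a2 - b2 by apply: ler_ltD => //; rewrite ltrN2.
  by have := med_antidiag_decr XY aa (ltW bb) ab'; rewrite g1 g2 !subrr ltxx.
have D : m 1 1 X Y a b = m (-1) (-1) X Y a b by rewrite -p1 -s1.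
have D' : m 1 1 X Y a' b' = m (-1) (-1) X Y a' b' by rewrite -p1' -s1'.
have G : m 1 (-1) X Y a b = m (-1) 1 X Y a b by rewrite -q1 -r1.
have G' : m 1 (-1) X Y a' b' = m (-1) 1 X Y a' b' by rewrite -q1' -r1'.
have [aa|aa|aa] := ltgtP a a'.
- by exfalso; apply: (lt_absurd _ _ _ _ D G D' G'); left.
- by exfalso; apply: (lt_absurd _ _ _ _ D' G' D G); left.
split => //; have [bb|bb|//] := ltgtP b b'.
- by exfalso; apply: (lt_absurd _ _ _ _ D G D' G'); right.
- by exfalso; apply: (lt_absurd _ _ _ _ D' G' D G); right.
Qed.

End spatial_partition.

(** * Four wedges of equal mass and their quarter turn *)

Section eight_partition_full_support.
Context {R : realType}.
Local Notation R3 := (R * R * R)%type.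
Variable nu : {measure set R3 -> \bar R}.
Hypothesis nu_fin : (nu setT < +oo)%E.
Hypothesis nu_plane : forall a b c e : R, [|| a != 0, b != 0 | c != 0] ->
  nu [set x | aff a b c e x = 0] = 0%E.
Hypothesis nu_open : forall U : set R3, open U -> measurable U -> U !=set0 ->
  0 < mass nu U.
Implicit Types (X Y f : R3 -> R) (Q : set R3).

Lemma balE Q f c : bal nu Q f c =
  mass nu (Q `&` half 1 (fun x => f x - c)) - mass nu (Q `&` half (-1) (fun x => f x - c)).
Proof.
rewrite /bal; congr (_ - _); congr (mass _ (_ `&` _));
  by apply/seteqP; split => x; rewrite /half/= => h; lra.
Qed.

Lemma mass_split Q f : measurable Q -> measurable_fun setT f ->
  nu [set x | f x = 0] = 0%E ->
  mass nu Q = mass nu (Q `&` half 1 f) + mass nu (Q `&` half (-1) f).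
Proof.
move=> mQ mf f0.
have mQh i : measurable (Q `&` half i f).
  by apply: measurableI => //; exact: measurable_half.
have mZ : measurable [set x | f x = 0] by exact: measurable_eq_set.
have mQ0 : measurable (Q `&` [set x | f x = 0]) by exact: measurableI.
have m0 : mass nu (Q `&` [set x | f x = 0]) = 0.
  apply/eqP; rewrite eq_le mass_ge0 andbT.
  have := @le_mass _ _ _ nu nu_fin _ [set x | f x = 0] mQ0 mZ.
  by rewrite {2}/mass f0; apply.
clear f0; have d1 : Q `&` half 1 f `&` (Q `&` half (-1) f) = set0.
  by apply/seteqP; split => // x; rewrite /half/= => -[[_ ?] [_ ?]]; lra.
have d2 : (Q `&` half 1 f `|` Q `&` half (-1) f) `&` (Q `&` [set x | f x = 0]) = set0.
  by apply/seteqP; split => // x; rewrite /half/= => -[[] [_ ?] [_ ?]]; lra.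
rewrite -[RHS]addr0 -m0 -(massU nu_fin _ _ d1)// -(massU nu_fin _ _ d2)//; last first.
  exact: measurableU.
congr (mass _ _); rewrite -!setIUr; apply/esym/setIidl => x _; rewrite /half/=.
by have [fx|fx|->] := ltgtP (f x) 0; [left; right; lra|left; left; lra|right].
Qed.

Lemma mass_half Q f c e : measurable Q -> measurable_fun setT f ->
  nu [set x | f x - c = 0] = 0%E -> bal nu Q f c = 0 -> e * e = 1 ->
  mass nu (Q `&` half e (fun x => f x - c)) = mass nu Q / 2.
Proof.
move=> mQ mf f0 b0 ee; rewrite (@mass_split Q (fun x => f x - c))//; last first.
  exact: measurable_funB.
by clear f0; move: b0; rewrite balE; case: (sqr_eq1 ee) => -> ?; lra.
Qed.

Definition lineX (p1 p2 c : R) : R3 -> R := aff p1 p2 0 (- c).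
Definition lineW (p1 p2 : R) : R3 -> R := aff (- p2) p1 0 0.
Definition lineY (p1 p2 c al be : R) : R3 -> R :=
  fun x => lineW p1 p2 x - al * lineX p1 p2 c x - be.

(* The first line has normal [(p1, p2)]; [al] is the slope of the second one in
   the orthogonal coordinates [lineX], [lineW]. *)
Definition halving (p1 p2 c al be : R) : Prop :=
  bal nu setT (aff p1 p2 0 0) c = 0 /\ forall e, e * e = 1 ->
  bal nu (half e (lineX p1 p2 c)) (fun x => lineW p1 p2 x - al * lineX p1 p2 c x) be = 0.

Lemma lineXE p1 p2 c : (fun x => aff p1 p2 0 0 x - c) = lineX p1 p2 c.
Proof. by apply/funext => x; rewrite /lineX /aff /= addr0. Qed.

Lemma indep_lineXW p1 p2 c : p1 * p1 + p2 * p2 != 0 ->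
  indep (lineX p1 p2 c) (lineW p1 p2).
Proof.
move=> p0; exists p1, p2, (- c), (- p2), p1, 0; split => //.
by rewrite mulNr opprK.
Qed.

Lemma indep_lineXY p1 p2 c al be : p1 * p1 + p2 * p2 != 0 ->
  indep (lineX p1 p2 c) (lineY p1 p2 c al be).
Proof.
move=> p0.
exists p1, p2, (- c), (- p2 - al * p1), (p1 - al * p2), (al * c - be); split => //.
  have -> : p1 * (p1 - al * p2) - (- p2 - al * p1) * p2 = p1 * p1 + p2 * p2 by ring.
  by [].
by apply/funext => x; rewrite /lineY /lineX /lineW /aff /=; ring.
Qed.

Lemma cuttable_line p1 p2 : p1 * p1 + p2 * p2 != 0 ->
  cuttable nu setT (aff p1 p2 0 0).
Proof.
move=> p0; apply: cuttable_aff => //; first exact: openT.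
  have [p10|//] := eqVneq p1 0; have [p20|//] := eqVneq p2 0.
  by move: p0; rewrite p10 p20 !mulr0 addr0 eqxx.
move=> u; have [x [xu _ _]] := indep_surj u 0 0 (indep_lineXW 0 p0).
by exists x => //; rewrite -xu /lineX oppr0.
Qed.

Lemma halving_exists {T : pseudoMetricType R} (p1 p2 : T -> R) :
  continuous p1 -> continuous p2 -> (forall t, p1 t * p1 t + p2 t * p2 t != 0) ->
  exists c al be : T -> R, [/\ continuous c, continuous al, continuous be &
    forall t, halving (p1 t) (p2 t) (c t) (al t) (be t)].
Proof.
move=> cp1 cp2 p0.
have caff (q1 q2 q : T -> R) : continuous q1 -> continuous q2 -> continuous q ->
    forall x : R3, continuous (fun t => aff (q1 t) (q2 t) 0 (q t) x).
  move=> c1 c2 c3 x t; apply: cvgD; last exact: c3.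
  apply: cvgD; last exact: cvg_cst.
  by apply: cvgD; apply: cvgM; try exact: cvg_cst; [exact: c1|exact: c2].
pose c t := med nu setT (aff (p1 t) (p2 t) 0 0).
have cc : continuous c.
  apply: continuous_med => //.
  - by move=> t; exact: cuttable_line.
  - by move=> t; exact: ae_stable_cst.
  - by move=> x; apply: caff => //; exact: cst_continuous.
have cN (g : T -> R) : continuous g -> continuous (fun t => - g t).
  by move=> cg t; apply: cvgN; exact: cg.
have [|||al [be [cal cbe H]]] := @halving_line_exists R nu nu_fin nu_plane nu_open T
    (fun t => lineX (p1 t) (p2 t) (c t)) (fun t => lineW (p1 t) (p2 t)).
- by move=> t; exact: indep_lineXW.
- by move=> x; apply: caff => //; exact: cN.
- by move=> x; apply: caff => //; [exact: cN|exact: cst_continuous].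
exists c, al, be; split => // t; split; last exact: H.
by apply: bal_med => //; exact: cuttable_line.
Qed.

Lemma halving_unique p1 p2 c al be c' al' be' : p1 * p1 + p2 * p2 != 0 ->
  halving p1 p2 c al be -> halving p1 p2 c' al' be' -> [/\ c = c', al = al' & be = be'].
Proof.
move=> p0 [H1 H2] [H1' H2'].
have cc : c = c'.
  by rewrite (med_unique nu_fin (cuttable_line p0) H1) (med_unique nu_fin (cuttable_line p0) H1').
rewrite -cc in H2'.
by have [] := halving_line_unique nu_fin nu_plane nu_open (indep_lineXW c p0) H2 H2'.
Qed.

Lemma halving_half p1 p2 c al be e : p1 * p1 + p2 * p2 != 0 ->
  halving p1 p2 c al be -> e * e = 1 ->
  mass nu (half e (lineX p1 p2 c)) = mass nu setT / 2.
Proof.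
move=> p0 [H _] ee; rewrite -lineXE -(mass_half (f := aff p1 p2 0 0) (c := c) _ _ _ _ ee)//.
- by rewrite setTI.
- exact: measurable_aff.
- have := indep_null nu_plane (indep_lineXW c p0); rewrite -lineXE; exact.
Qed.

Lemma halving_quarter p1 p2 c al be e1 e2 : p1 * p1 + p2 * p2 != 0 ->
  halving p1 p2 c al be -> e1 * e1 = 1 -> e2 * e2 = 1 ->
  mass nu (wedge e1 e2 (lineX p1 p2 c) (lineY p1 p2 c al be)) = mass nu setT / 4.
Proof.
move=> p0 H ee1 ee2; have hX := halving_half p0 H ee1; have [_ /(_ _ ee1) Hb] := H.
have XW := indep_lineXW c p0.
have := @mass_half (half e1 (lineX p1 p2 c))
  (fun x => lineW p1 p2 x - al * lineX p1 p2 c x) be e2 _ _ _ Hb ee2.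
rewrite -/(lineY p1 p2 c al be) /wedge => ->.
- by rewrite hX; field.
- by apply: measurable_half; exact: indep_measurable XW.
- apply: measurable_funB; first exact: indep_measurable (indep_sym XW).
  by apply: measurable_funM => //; exact: indep_measurable XW.
- exact: indep_null (indep_sym (indep_lineXY c al be p0)).
Qed.

(* Exchanging the roles of the two lines is a quarter turn: the new first line
   is the old second one, and the new second line is the old first one with its
   sides exchanged. *)
Lemma halving_turn c al be : halving 1 0 c al be ->
  halving (- al) 1 (be - al * c) (- al) (- al * (be - al * c) - (1 + al * al) * c).
Proof.
move=> H; set c' := be - al * c; set be' := - al * c' - _.
have p0 : 1 * 1 + 0 * 0 != 0 :> R by rewrite mul1r mul0r addr0 oner_eq0.
have XE : lineX (- al) 1 c' = lineY 1 0 c al be.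
  by apply/funext => x; rewrite /lineY /lineX /lineW /aff /c' /=; ring.
(* The constant [be'] is chosen to make the new second functional a negative multiple of the old
   first one. *)
have YE : lineY (- al) 1 c' (- al) be' = fun x => - (1 + al * al) * lineX 1 0 c x.
  by apply/funext => x; rewrite /be' /lineY /lineX /lineW /aff /c' /=; ring.
have k0 : 0 < 1 + al * al by rewrite ltr_pwDl// -expr2 sqr_ge0.
have q e1 e2 := halving_quarter (e1 := e1) (e2 := e2) p0 H.
have halfN e : half e (lineY (- al) 1 c' (- al) be') = half (- e) (lineX 1 0 c).
  have E x : e * (- (1 + al * al) * lineX 1 0 c x) = (1 + al * al) * (- e * lineX 1 0 c x).
    by ring.
  by rewrite YE; apply/seteqP; split => x; rewrite /half/= E (pmulr_rgt0 _ k0).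
have one2 : (1 : R) * 1 = 1 by rewrite mulr1.
have mone2 : (-1 : R) * -1 = 1 by rewrite mulrNN mulr1.
split.
  rewrite balE !setTI lineXE XE.
  have XY := indep_lineXY c al be p0; set Y := lineY 1 0 c al be in XY *.
  set X := lineX 1 0 c in XY.
  (* Each side of the old second line consists, up to a null set, of two quarter wedges. *)
  have hY e : e * e = 1 -> mass nu (half e Y) = mass nu setT / 2.
    move=> ee; have mX := indep_measurable XY; have mY := indep_measurable (indep_sym XY).
    rewrite (mass_split (measurable_half e mY) mX (indep_null nu_plane XY)).
    by rewrite ![half e _ `&` _]setIC !q//; field.
  by rewrite !hY// subrr.
move=> e ee; rewrite balE -/(lineY (- al) 1 c' (- al) be') !halfN XE.
by rewrite ![half e _ `&` _]setIC !q ?opprK// subrr.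
Qed.

End eight_partition_full_support.

(** * The intermediate value argument along a quarter turn *)

Section full_support.
Context {R : realType}.
Local Notation R3 := (R * R * R)%type.
Variable nu : {measure set R3 -> \bar R}.
Hypothesis nu_fin : (nu setT < +oo)%E.
Hypothesis nu_plane : forall a b c e : R, [|| a != 0, b != 0 | c != 0] ->
  nu [set x | aff a b c e x = 0] = 0%E.
Hypothesis nu_open : forall U : set R3, open U -> measurable U -> U !=set0 ->
  0 < mass nu U.

(** The turn carries diagonal wedges to antidiagonal ones, which exchanges the two common medians;
    the factor [k] only rescales a slope. *)
Lemma balanced_turn (X Y : R3 -> R) (k a b c d : R) : 0 < k ->
  balanced nu Y (fun x => - k * X x) a b c d -> balanced nu X Y (- (b * k)) a d c.
Proof.
move=> k0 H e1 e2 ee1 ee2.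
have := H e2 (- e1) ee2; rewrite mulrNN => /(_ ee1).
have -> : wedge e2 (- e1) Y (fun x => - k * X x) = wedge e1 e2 X Y.
  rewrite wedge_swap /wedge; congr (_ `&` _).
  have E x : - e1 * (- k * X x) = k * (e1 * X x) by ring.
  by apply/seteqP; split => x; rewrite /half/= E (pmulr_rgt0 _ k0).
have -> : height a b Y (fun x => - k * X x) = height (- (b * k)) a X Y.
  by apply/funext => x; rewrite /height; ring.
congr (bal _ _ _ _ = 0).
have n1 : (1 == -1 :> R) = false by apply/eqP; lra.
have n2 : (-1 == 1 :> R) = false by apply/eqP; lra.
by case: (sqr_eq1 ee1) => ->; case: (sqr_eq1 ee2) => ->;
  rewrite ?opprK ?eqxx ?n1 ?n2 //.
Qed.

Lemma eight_partition_full_support : exists (X Y : R3 -> R) (a b c : R),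
  indep X Y /\ forall e1 e2 e3, e1 * e1 = 1 -> e2 * e2 = 1 -> e3 * e3 = 1 ->
  mass nu (wedge e1 e2 X Y `&` half e3 (fun x => height a b X Y x - c)) =
  mass nu setT / 8.
Proof.
have cst (r : R) : continuous (fun _ : R => r) by exact: cst_continuous.
(* The pair of lines for the constant direction [(1, 0)] comes first: its slope [al0] determines
   where the path of directions must end. *)
have [|c_ [al_ [be_ [_ _ _ H_]]]] := halving_exists nu_fin nu_plane nu_open (cst 1) (cst 0).
  by move=> _; rewrite mul1r mul0r addr0 oner_neq0.
move: {H_ c_ al_ be_} (c_ 0) (al_ 0) (be_ 0) (H_ 0) => c0 al0 be0 H0.
(* The normals run along a straight line from [(1, 0)] at 0 to [(- al0, 1)], the normal of the
   second line, at 1. It misses the origin, since [p2] vanishes only at 0, where [p1] is 1. *)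
pose p1 (s : R) := 1 - s * (1 + al0); pose p2 (s : R) := s.
have cp2 : continuous p2 by move=> s; exact: cvg_id.
have cp1 : continuous p1.
  by move=> s; apply: cvgB; [exact: cvg_cst|apply: cvgM; [exact: cvg_id|exact: cvg_cst]].
have p0 s : p1 s * p1 s + p2 s * p2 s != 0.
  rewrite gt_eqF// -!expr2 /p1 /p2; have [->|s0] := eqVneq s 0.
    by rewrite mul0r subr0 expr1n expr0n addr0.
  by rewrite ltr_wpDl ?sqr_ge0// exprn_even_gt0.
have [c [al [be [cc cal cbe H]]]] := halving_exists nu_fin nu_plane nu_open cp1 cp2 p0.
pose X s := lineX (p1 s) (p2 s) (c s).
pose Y s := lineY (p1 s) (p2 s) (c s) (al s) (be s).
have XY s : indep (X s) (Y s) by exact: indep_lineXY.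
have caff (q1 q2 q : R -> R) : continuous q1 -> continuous q2 -> continuous q ->
    forall x : R3, continuous (fun t => aff (q1 t) (q2 t) 0 (q t) x).
  move=> c1 c2 c3 x t; apply: cvgD; last exact: c3.
  apply: cvgD; last exact: cvg_cst.
  by apply: cvgD; apply: cvgM; try exact: cvg_cst; [exact: c1|exact: c2].
have cN (g : R -> R) : continuous g -> continuous (fun t => - g t).
  by move=> cg t; apply: cvgN; exact: cg.
have cX x : continuous (X^~ x) by apply: caff => //; exact: cN.
have cY x : continuous (Y^~ x).
  move=> s; apply: cvgB; last exact: cbe.
  apply: cvgB; first by apply: caff => //; exact: cN.
  by apply: cvgM; [exact: cal|exact: cX].
have [a [b [u [w [cu cw B]]]]] := balanced_exists nu_fin nu_plane nu_open XY cX cY.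
have p10 : p1 0 = 1 by rewrite /p1 mul0r subr0.
have p11 : p1 1 = - al0 by rewrite /p1; ring.
have [cE aE bE] : [/\ c 0 = c0, al 0 = al0 & be 0 = be0].
  have := H 0; rewrite p10 => H00.
  by apply: (halving_unique nu_fin nu_plane nu_open _ H00 H0); have := p0 0; rewrite p10.
(* By uniqueness the family arrives at the quarter turn of the initial pair, so [u - w] takes
   opposite values at 0 and 1. *)
have turn : [/\ u 1 = w 0 & w 1 = u 0].
  have T := halving_turn nu_fin nu_plane H0.
  have := H 1; rewrite p11 => H1.
  have [c1 a1 b1] : [/\ c 1 = be0 - al0 * c0, al 1 = - al0 &
      be 1 = - al0 * (be0 - al0 * c0) - (1 + al0 * al0) * c0].
    by apply: (halving_unique nu_fin nu_plane nu_open _ H1 T); have := p0 1; rewrite p11.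
  have k0 : 0 < 1 + al0 * al0 by rewrite ltr_pwDl// -expr2 sqr_ge0.
  have X1 : X 1 = Y 0.
    rewrite /X /Y p11 p10 c1 cE aE bE; apply/funext => x.
    by rewrite /lineY /lineX /lineW /aff /p2 /=; ring.
  have Y1 : Y 1 = fun x => - (1 + al0 * al0) * X 0 x.
    rewrite /X /Y p11 p10 c1 a1 b1 cE; apply/funext => x.
    by rewrite /lineY /lineX /lineW /aff /p2 /=; ring.
  have := B 1; rewrite X1 Y1 => /(balanced_turn k0) B1.
  by have [-> ->] := balanced_unique nu_fin nu_plane nu_open (XY 0) (B 0) B1.
have [s _ us] : exists2 s, s \in `[0, 1] & u s - w s = 0.
  apply: IVT => //.
    by apply: continuous_subspaceT => s; apply: cvgB; [exact: cu|exact: cw].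
  rewrite ge_min le_max; have [-> ->] := turn.
  have [?|?] := leP (u 0) (w 0); apply/andP; split; apply/orP; lra.
exists (X s), (Y s), (a s), (b s), (u s); split => // e1 e2 e3 ee1 ee2 ee3.
have hq := halving_quarter nu_fin nu_plane (p0 s) (H s) ee1 ee2.
have [k [l [e [E nz]]]] := height_aff (a s) (b s) (XY s).
rewrite (mass_half nu_fin _ _ _ _ ee3).
- by rewrite hq; field.
- exact: measurable_wedge.
- by rewrite E; exact: measurable_aff.
- rewrite -(nu_plane (e - u s) nz) E; congr (nu _).
  by apply/seteqP; split => x; rewrite /aff/= => ?; lra.
- have := B s e1 e2 ee1 ee2; have -> : w s = u s by lra.
  by case: ifP.
Qed.

End full_support.

(** * Arbitrary mass distributions *)

Section gaussian.
Context {R : realType}.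
Local Notation R3 := (R * R * R)%type.
Local Open Scope ereal_scope.

Let measurable_ocitv_id :
  measurable_fun setT (fun x : measurableTypeR R => (x : R)).
Proof. by move=> _ Y mY; rewrite setTI. Qed.

(* [normal_prob] lives on [measurableTypeR R], whose display differs from the
   one of [R]; pushing it forward along the identity moves it to [R]. *)
Definition gauss1 : probability R R :=
  distribution (normal_prob (0 : R) 1) (mfun_Sub (mem_set measurable_ocitv_id)).

Local Notation N := gauss1.

Lemma gauss1_set1 (x : R) : N [set x] = 0.
Proof.
have /null_content_dominatesP := @normal_prob_dominates R 0%R 1%R.
by apply => //; exact: lebesgue_measure_set1.
Qed.

(** The density is positive everywhere, so a vanishing integral would make the interval Lebesgue
    negligible, against its length [b - a]. *)
Lemma gauss1_itv_gt0 (a b : R) : (a < b)%R -> 0 < N `]a, b[%classic.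
Proof.
move=> ab; rewrite lt0e measure_ge0 andbT; apply/eqP => N0.
have mf : measurable_fun `]a, b[%classic (EFin \o normal_pdf (0 : R) 1).
  by apply/measurable_EFinP/measurable_funTS; exact: measurable_normal_pdf.
have : \int[lebesgue_measure]_(x in `]a, b[) `|(EFin \o normal_pdf (0 : R) 1) x| = 0.
  rewrite -[RHS]N0; apply: eq_integral => x _ /=.
  by rewrite ger0_norm// normal_pdf_ge0.
move=> i0; have ae0 := (ae_eq_integral_abs lebesgue_measure (measurable_itv _) mf).1 i0.
have : (@lebesgue_measure R).-negligible `]a, b[%classic.
  apply: negligibleS ae0 => x abx /= /(_ abx) [/eqP].
  by rewrite normal_pdfE ?oner_eq0// mulf_eq0 gt_eqF ?gt_eqF ?expR_gt0//
    normal_peak_gt0// oner_eq0.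
move/negligibleP => /(_ (measurable_itv _)).
move=> m0; have := lebesgue_measure_itv `]a, b[.
by rewrite [LHS]m0 /= lte_fin ab -EFinD => -[] /eqP; rewrite eq_sym subr_eq0 gt_eqF.
Qed.

Definition gauss3 : {measure set R3 -> \bar R} := ((N \x N) \x N).

Lemma gauss3_setT : gauss3 setT = 1.
Proof. exact: probability_setT. Qed.

(** Fubini: along a coordinate with non-zero coefficient every slice of the plane is a single point.
    When [c] vanishes the plane is a cylinder, and the argument descends to fewer coordinates. *)
Lemma gauss3_plane (a b c e : R) : [|| a != 0, b != 0 | c != 0]%R ->
  gauss3 [set x | aff a b c e x = 0%R] = 0.
Proof.
have root (k l : R) : k != 0%R -> N [set z | (k * z + l = 0)%R] = 0.
  move=> k0; rewrite [X in N X](_ : _ = [set (- l / k)%R]) ?gauss1_set1//.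
  apply/seteqP; split => z /= => [h|->]; last by field.
  by apply: (mulfI k0); rewrite mulrCA divff// mulr1; lra.
have [c0|c0 _] := eqVneq c 0%R; last first.
  rewrite /gauss3 /=; apply: integral0_eq => x _ /=.
  rewrite -[RHS](root c (a * x.1 + b * x.2 + e)%R c0); congr (N _).
  by apply/seteqP; split => z; rewrite /xsection/= inE /aff/= => h; lra.
rewrite orbF => ab0.
pose L := [set x : R * R | (a * x.1 + b * x.2 + e = 0)%R].
have mL : measurable L.
  apply: measurable_eq_set => //; apply: measurable_funD => //.
  by apply: measurable_funD; apply: measurable_funM.
rewrite [X in gauss3 X](_ : _ = L `*` setT); last first.
  by apply/seteqP; split => -[x z]; rewrite /L /aff/= c0 mul0r addr0 //= => -[].
suff N2L : (N \x N) L = 0.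
  rewrite /gauss3/= product_measure1E//; apply/eqP; rewrite mule_eq0.
  by apply/orP; left; apply/eqP; exact: N2L.
have [b0|b0] := eqVneq b 0%R; last first.
  apply: integral0_eq => x _ /=.
  rewrite -[RHS](root b (a * x + e)%R b0); congr (N _).
  by apply/seteqP; split => z; rewrite /xsection/= inE /L/= => h; lra.
have a0 : a != 0%R by move: ab0; rewrite b0 eqxx orbF.
rewrite (_ : L = [set z | (a * z + e = 0)%R] `*` setT); last first.
  by apply/seteqP; split => -[x z]; rewrite /L/= b0 mul0r addr0 //= => -[].
rewrite product_measure1E//=; last first.
  by apply: measurable_eq_set => //; apply: measurable_funD.
by apply/eqP; rewrite mule_eq0; apply/orP; left; apply/eqP; exact: root.
Qed.

(** The set contains a cube, whose mass is a product of three positive masses of intervals. *)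
Lemma gauss3_open (U : set R3) : open U -> measurable U -> U !=set0 -> 0 < gauss3 U.
Proof.
move=> oU mU [[[x y] z] Ux].
have /nbhs_ballP[r /= r0 rU] := open_nbhs_nbhs (conj oU Ux).
pose I (t : R) := `](t - r)%R, (t + r)%R[%classic.
have mI t : measurable (I t) by exact: measurable_itv.
have Ipos t : 0 < N (I t) by apply: gauss1_itv_gt0; lra.
have IU : I x `*` I y `*` I z `<=` U.
  move=> [[x' y'] z'] /= [[Ix Iy] Iz]; apply: rU.
  have bI t t' : I t t' -> ball t r t'.
    by rewrite /I/= in_itv/= /ball/= ltr_norml => /andP[? ?]; apply/andP; split; lra.
  by split; [split|]; apply: bI.
apply: (@lt_le_trans _ _ (gauss3 (I x `*` I y `*` I z))); last first.
  apply: le_measure; rewrite ?inE//.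
  by apply: measurableX => //; exact: measurableX.
have N2 : 0 < (N \x N) (I x `*` I y).
  rewrite product_measure1E//; apply: mule_gt0; exact: Ipos.
rewrite /gauss3/= product_measure1E//; last exact: measurableX.
by apply: mule_gt0; [exact: N2|exact: Ipos].
Qed.

End gaussian.

(** * Passage to the limit by compactness *)

Section limit.
Context {R : realType}.
Local Notation R3 := (R * R * R)%type.
Local Notation R4 := (R * R * R * R)%type.

Definition ev (k : R4) : R3 -> R := aff k.1.1.1 k.1.1.2 k.1.2 k.2.

(** Including the constant term in the normalisation makes this set compact, at the price of
    admitting non-zero constant functionals as limits. *)
Definition unit_coef : set R4 :=
  [set k | `|k.1.1.1| + `|k.1.1.2| + `|k.1.2| + `|k.2| = 1].

Definition octant (e1 e2 e3 : R) (k : R4 * R4 * R4) : set R3 :=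
  half e1 (ev k.1.1) `&` half e2 (ev k.1.2) `&` half e3 (ev k.2).

Lemma measurable_ev k : measurable_fun setT (ev k).
Proof. exact: measurable_aff. Qed.

Lemma measurable_octant e1 e2 e3 k : measurable (octant e1 e2 e3 k).
Proof.
by apply: measurableI; [apply: measurableI|]; apply: measurable_half;
  exact: measurable_ev.
Qed.

Let c1 : continuous (fun k : R4 => k.1.1.1).
Proof.
move=> k; apply: (@continuous_comp _ _ _ (fun k : R4 => k.1.1) fst); last exact: cvg_fst.
by apply: (@continuous_comp _ _ _ fst fst); exact: cvg_fst.
Qed.

Let c2 : continuous (fun k : R4 => k.1.1.2).
Proof.
move=> k; apply: (@continuous_comp _ _ _ (fun k : R4 => k.1.1) snd); last exact: cvg_snd.
by apply: (@continuous_comp _ _ _ fst fst); exact: cvg_fst.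
Qed.

Let c3 : continuous (fun k : R4 => k.1.2).
Proof.
by move=> k; apply: (@continuous_comp _ _ _ fst snd); [exact: cvg_fst|exact: cvg_snd].
Qed.

Let c4 : continuous (fun k : R4 => k.2).
Proof. by move=> k; exact: cvg_snd. Qed.

Lemma continuous_ev x : continuous (ev^~ x).
Proof.
move=> k; apply: cvgD; last exact: c4.
by apply: cvgD; [apply: cvgD|]; apply: cvgM; try exact: cvg_cst;
  [exact: c1|exact: c2|exact: c3].
Qed.

Lemma closed_unit_coef : closed unit_coef.
Proof.
apply: (@closed_comp _ _ (fun k : R4 => `|k.1.1.1| + `|k.1.1.2| + `|k.1.2| + `|k.2|)
  [set 1]); last exact: closed_eq.
by move=> k _; apply: cvgD; [apply: cvgD; [apply: cvgD|]|]; apply: cvg_norm;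
  [exact: c1|exact: c2|exact: c3|exact: c4].
Qed.

Lemma compact_unit_coef : compact unit_coef.
Proof.
pose I : set R := `[-1, 1]%classic.
have cI : compact I by exact: segment_compact.
apply: (@subclosed_compact _ _ (I `*` I `*` I `*` I)).
- exact: closed_unit_coef.
- by apply: compact_setX => //; apply: compact_setX => //; exact: compact_setX.
- move=> [[[a b] c] e]; rewrite /unit_coef/= => k1.
  have := normr_ge0 a; have := normr_ge0 b; have := normr_ge0 c; have := normr_ge0 e.
  by move=> ? ? ? ?; split; [split; [split|]|]; rewrite /I/= in_itv/= -ler_norml; lra.
Qed.

Lemma closed_horizontal : closed [set k : R4 | k.1.2 = 0].
Proof.
by apply: (@closed_comp _ _ (fun k : R4 => k.1.2) [set 0]); [move=> k _; exact: c3|exact: closed_eq].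
Qed.

(** Division by a positive number keeps the half-spaces, and also keeps vertical planes vertical. *)
Lemma normalize_aff a b c e : [|| a != 0, b != 0 | c != 0] ->
  exists k, [/\ unit_coef k, c = 0 -> k.1.2 = 0 &
    forall s, half s (aff a b c e) = half s (ev k)].
Proof.
move=> abc; pose r := `|a| + `|b| + `|c| + `|e|.
have r0 : 0 < r.
  rewrite lt_def; apply/andP; split; last by rewrite !addr_ge0.
  apply: contraTneq abc; rewrite /r => /eqP.
  by rewrite !paddr_eq0 ?addr_ge0// !normr_eq0 => /andP[/andP[/andP[-> ->] ->] _].
exists (a / r, b / r, c / r, e / r); split.
- rewrite /unit_coef/= !normrM normfV (gtr0_norm r0) -!mulrDl.
  by rewrite divff// gt_eqF.
- by move=> /= ->; rewrite mul0r.
- have i0 : 0 < r^-1 by rewrite invr_gt0.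
  have E s x : s * ev (a / r, b / r, c / r, e / r) x = r^-1 * (s * aff a b c e x).
    by rewrite /ev /aff/=; ring.
  by move=> s; apply/seteqP; split => x; rewrite /half/= E (pmulr_rgt0 _ i0).
Qed.

Section mass_of_octants.
Variable mu : {measure set R3 -> \bar R}.
Hypothesis mu_fin : (mu setT < +oo)%E.
Hypothesis mu_plane : forall a b c e : R, [|| a != 0, b != 0 | c != 0] ->
  mu [set x | aff a b c e x = 0] = 0%E.

(** A constant functional with normalised coefficients is not zero, so its zero set is empty; all
    others vanish on a plane. *)
Lemma ev_null k : unit_coef k -> mu [set x | ev k x = 0] = 0%E.
Proof.
move=> k1; have [|abc] := boolP [|| k.1.1.1 != 0, k.1.1.2 != 0 | k.1.2 != 0].
  exact: mu_plane.
move: abc; rewrite !negb_or !negbK => /and3P[/eqP a0 /eqP b0 /eqP d0].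
rewrite [X in mu X](_ : _ = set0) ?measure0//; apply/seteqP; split => // x.
rewrite /ev /aff/= a0 b0 d0 !mul0r !add0r => e0.
move: k1; rewrite /unit_coef/= a0 b0 d0 e0 !normr0 !addr0 => /esym/eqP.
by rewrite oner_eq0.
Qed.

Lemma ev_stable {T : pseudoMetricType R} (h : T -> R4) t e : e * e = 1 ->
  continuous h -> unit_coef (h t) -> ae_stable mu (fun s => half e (ev (h s))) t.
Proof.
move=> ee ch h1.
apply: (@ae_stable_lt _ _ _ _ _ (fun _ _ => 0) (fun s x => e * ev (h s) x)) => //.
- by apply: measurable_funM => //; exact: measurable_ev.
- rewrite -(ev_null h1); congr (mu _); apply/seteqP; split => x /=.
    by move=> h0; rewrite -[ev _ x]mul1r -ee -mulrA -h0 mulr0.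
  by move=> ->; rewrite mulr0.
- by move=> x; exact: cvg_cst.
- move=> x; apply: cvgM; first exact: cvg_cst.
  by apply: (@continuous_comp _ _ _ h (ev^~ x)); [exact: ch|exact: continuous_ev].
Qed.

Lemma cvg_mass_octant e1 e2 e3 k : e1 * e1 = 1 -> e2 * e2 = 1 -> e3 * e3 = 1 ->
  unit_coef k.1.1 -> unit_coef k.1.2 -> unit_coef k.2 ->
  mass mu (octant e1 e2 e3 l) @[l --> k] --> mass mu (octant e1 e2 e3 k).
Proof.
move=> ee1 ee2 ee3 k1 k2 k3; apply: (cvg_mass_stable mu_fin).
  by move=> s; exact: measurable_octant.
apply: ae_stableI; first apply: ae_stableI.
- apply: (@ev_stable _ (fun k : R4 * R4 * R4 => k.1.1)) => // l.
  by apply: (@continuous_comp _ _ _ fst fst); exact: cvg_fst.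
- apply: (@ev_stable _ (fun k : R4 * R4 * R4 => k.1.2)) => // l.
  by apply: (@continuous_comp _ _ _ fst snd); [exact: cvg_fst|exact: cvg_snd].
- by apply: (@ev_stable _ (fun k : R4 * R4 * R4 => k.2)) => // l; exact: cvg_snd.
Qed.

(* Perturbing [mu] by a small Gaussian makes its support full. *)
Lemma approximate_partition (n : nat) : exists k : R4 * R4 * R4,
  [/\ unit_coef k.1.1 /\ k.1.1.1.2 = 0, unit_coef k.1.2 /\ k.1.2.1.2 = 0, unit_coef k.2 &
  forall e1 e2 e3, e1 * e1 = 1 -> e2 * e2 = 1 -> e3 * e3 = 1 ->
  `|mass mu (octant e1 e2 e3 k) - mass mu setT / 8| <= n.+1%:R^-1].
Proof.
(* Here [s] is the Gaussian share of an octant and [r] the total Gaussian mass, so [p - t / 8]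
   equals [r / 8 - s]. *)
have close (p t r s : R) : p + s = (t + r * 1) / 8 -> 0 <= s -> s <= r ->
    `|p - t / 8| <= r.
  by move=> *; rewrite ler_norml; apply/andP; split; lra.
have r0 : 0 <= n.+1%:R^-1 :> R by rewrite invr_ge0.
pose nu : {measure set R3 -> \bar R} := measure_add mu (mscale (NngNum r0) gauss3).
have g_fin : ((@gauss3 R) setT < +oo)%E by rewrite gauss3_setT ltry.
have nuE A : measurable A -> nu A = (mass mu A + n.+1%:R^-1 * mass gauss3 A)%:E.
  move=> mA; rewrite [LHS]measure_addE /= /mscale/= (massE mu_fin mA).
  by rewrite (massE g_fin mA) -EFinM -EFinD.
have massnu A : measurable A -> mass nu A = mass mu A + n.+1%:R^-1 * mass gauss3 A.
  by move=> mA; rewrite /mass nuE.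
have nu_fin : (nu setT < +oo)%E by rewrite nuE// ltry.
have nu_plane (a b c e : R) : [|| a != 0, b != 0 | c != 0] ->
    nu [set x | aff a b c e x = 0] = 0%E.
  move=> abc; rewrite nuE; last by apply: measurable_eq_set => //; exact: measurable_aff.
  by rewrite /mass mu_plane// gauss3_plane//= mulr0 addr0.
have nu_open (U : set R3) : open U -> measurable U -> U !=set0 -> 0 < mass nu U.
  move=> oU mU U0; rewrite massnu// ltr_wpDl ?mass_ge0// mulr_gt0 ?invr_gt0//.
  by rewrite -lte_fin -massE// gauss3_open.
have [X [Y [a [b [c [XY P]]]]]] := eight_partition_full_support nu_fin nu_plane nu_open.
have [a' [b' [e' [E' nz']]]] := height_aff a b XY.
have E : (fun x => height a b X Y x - c) = aff a' b' 1 (e' - c).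
  by apply/funext => x; rewrite E' /aff addrA.
move: P; rewrite E.
have [a1 [b1 [u1 [a2 [b2 [u2 [dt XE YE]]]]]]] := XY.
have nz1 : [|| a1 != 0, b1 != 0 | (0 : R) != 0].
  have [h1|//] := eqVneq a1 0; have [h2|//] := eqVneq b1 0.
  by move: dt; rewrite h1 h2 mul0r mulr0 subrr eqxx.
have nz2 : [|| a2 != 0, b2 != 0 | (0 : R) != 0].
  have [h1|//] := eqVneq a2 0; have [h2|//] := eqVneq b2 0.
  by move: dt; rewrite h1 h2 mul0r mulr0 subrr eqxx.
have [k1 [U1 /(_ erefl) H1 hk1]] := normalize_aff u1 nz1.
have [k2 [U2 /(_ erefl) H2 hk2]] := normalize_aff u2 nz2.
have [k3 [U3 _ hk3]] := normalize_aff (e' - c) nz'.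
move=> P; exists (k1, k2, k3); split => // e1 e2 e3 ee1 ee2 ee3.
have := P e1 e2 e3 ee1 ee2 ee3; rewrite /wedge XE YE hk1 hk2 hk3.
rewrite -/(octant e1 e2 e3 (k1, k2, k3)) !massnu//; last exact: measurable_octant.
set O := octant _ _ _ _.
have g1 : mass gauss3 setT = 1 :> R by rewrite /mass gauss3_setT.
have gO : mass gauss3 O <= 1 :> R.
  by rewrite -g1 le_mass//; exact: measurable_octant.
have := mass_ge0 gauss3 O; rewrite g1; set r := _^-1 => gO0 h.
have rg0 : 0 <= r * mass gauss3 O by rewrite mulr_ge0.
have rg1 : r * mass gauss3 O <= r by rewrite -[leRHS]mulr1 ler_wpM2l.
exact: close h rg0 rg1.
Qed.

Lemma limit_partition : exists k : R4 * R4 * R4,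
  [/\ k.1.1.1.2 = 0, k.1.2.1.2 = 0 &
  forall e1 e2 e3, e1 * e1 = 1 -> e2 * e2 = 1 -> e3 * e3 = 1 ->
  mass mu (octant e1 e2 e3 k) = mass mu setT / 8].
Proof.
have /choice[u uP] := approximate_partition.
pose S0 := unit_coef `&` [set k : R4 | k.1.2 = 0].
have cS0 : compact S0.
  apply: (subclosed_compact _ compact_unit_coef); last by move=> x [].
  by apply: closedI; [exact: closed_unit_coef|exact: closed_horizontal].
have cK : compact (S0 `*` S0 `*` unit_coef).
  by apply: compact_setX; [exact: compact_setX|exact: compact_unit_coef].
have [|k [[[[k1 k1z] [k2 k2z]] k3] kcl]] := cK (u n @[n --> \oo]) _.
  by exists 0%N => // n _ /=; have [[? ?] [? ?] ? _] := uP n.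
exists k; split => // e1 e2 e3 ee1 ee2 ee3; apply/eqP; rewrite -subr_eq0 -normr_eq0.
apply: contraT => d0; set d := `| _ | in d0.
have {d0}d0 : 0 < d by rewrite lt_def d0 /d normr_ge0.
have d2 : 0 < d / 2 by rewrite divr_gt0.
have /cvgrPdist_lt/(_ _ d2) near_k := cvg_mass_octant ee1 ee2 ee3 k1 k2 k3.
pose A := [set l | `|mass mu (octant e1 e2 e3 l) - mass mu setT / 8| < d / 2].
have near_u : \forall n \near \oo, A (u n).
  near=> n; have [_ _ _ /(_ e1 e2 e3 ee1 ee2 ee3) un] := uP n.
  by apply: (le_lt_trans un); near: n; exact: (near_infty_natSinv_lt (PosNum d2)).
(* Near the cluster point some [l] has an octant mass within [d / 2] both of one eighth and of the
   mass for [k], although these two differ by [d]. *)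
have [l [/= lu lk]] := kcl A _ near_u near_k.
have : d < d / 2 + d / 2.
  apply: le_lt_trans (ltrD lk lu); rewrite /d.
  by rewrite -[X in `|X|](subrKA (mass mu (octant e1 e2 e3 l))) ler_normD.
by rewrite -splitr ltxx.
Unshelve. all: by end_near. Qed.

End mass_of_octants.
End limit.

(** * Non-degeneracy of the limit planes *)

Section eight_partition_R3.
Context {R : realType}.
Local Notation R3 := (R * R * R)%type.
Local Notation R4 := (R * R * R * R)%type.

(** With zero determinant a non-trivial combination of the functionals, with coefficients [l] and
    [m], is constant. It is positive at a point where their signs match those of [l] and [m], and
    negative where both are opposite. *)
Lemma indep_of_octants (k1 k2 : R4) : k1.1.2 = 0 -> k2.1.2 = 0 ->
  (forall e1 e2, e1 * e1 = 1 -> e2 * e2 = 1 ->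
    exists x, 0 < e1 * ev k1 x /\ 0 < e2 * ev k2 x) ->
  k1.1.1.1 * k2.1.1.2 - k2.1.1.1 * k1.1.1.2 != 0.
Proof.
move: k1 k2 => [[[a b] c] e] [[[a' b'] c'] e'] /= -> -> H; apply/negP => /eqP dt.
have [l [m [lm0 la lb]]] : exists l m : R,
    [/\ (l != 0) || (m != 0), l * a + m * a' = 0 & l * b + m * b' = 0].
  have [a0|a0] := boolP ((a != 0) || (a' != 0)).
    by exists a', (- a); split; [rewrite oppr_eq0 orbC|ring|rewrite -[RHS]oppr0 -dt; ring].
  have [b0|b0] := boolP ((b != 0) || (b' != 0)).
    by exists b', (- b); split; [rewrite oppr_eq0 orbC|rewrite -[RHS]dt; ring|ring].
  move: a0 b0; rewrite !negb_or !negbK => /andP[/eqP-> /eqP->] /andP[/eqP-> /eqP->].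
  by exists 1, 0; rewrite oner_eq0 !mulr0 addr0.
(* The sign of 0 is set to 1, so that signs always square to 1. *)
pose sg (r : R) : R := if 0 <= r then 1 else -1.
have sg2 r : sg r * sg r = 1 by rewrite /sg; case: ifP => _; rewrite ?mulr1 ?mulrNN ?mulr1.
have sgE r : r = `|r| * sg r.
  by rewrite /sg; case: ger0P => _; rewrite ?mulr1 // mulrN1 opprK.
have comb x : l * ev (a, b, 0, e) x + m * ev (a', b', 0, e') x = l * e + m * e'.
  rewrite /ev /aff /=.
  have -> : l * (a * x.1.1 + b * x.1.2 + 0 * x.2 + e) +
      m * (a' * x.1.1 + b' * x.1.2 + 0 * x.2 + e') =
      (l * a + m * a') * x.1.1 + (l * b + m * b') * x.1.2 + (l * e + m * e') by ring.
  by rewrite la lb !mul0r !add0r.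
have pos (r y : R) : 0 < y -> 0 <= `|r| * y by move=> y0; rewrite mulr_ge0 ?normr_ge0 // ltW.
have pos' (r y : R) : r != 0 -> 0 < y -> 0 < `|r| * y by move=> r0 y0; apply: mulr_gt0; rewrite ?normr_gt0.
have sum_gt0 (y z : R) : 0 < y -> 0 < z -> 0 < `|l| * y + `|m| * z.
  move=> y0 z0; case/orP: lm0 => [l0|m0].
    by apply: ltr_wpDr; [exact: pos|exact: pos'].
  by apply: ltr_wpDl; [exact: pos|exact: pos'].
have [x [x1 x2]] := H _ _ (sg2 l) (sg2 m).
have sgN2 r : - sg r * - sg r = 1 by rewrite mulrNN.
have [y [y1 y2]] := H _ _ (sgN2 l) (sgN2 m).
have := sum_gt0 _ _ x1 x2; have := sum_gt0 _ _ y1 y2.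
rewrite !mulNr !mulrN !mulrA -!sgE -opprD !comb oppr_gt0 => h1 h2.
by move: (lt_trans h1 h2); rewrite ltxx.
Qed.

Variable mu : {measure set R3 -> \bar R}.
Hypothesis mu_fin : (mu setT < +oo)%E.
Hypothesis mu_plane : forall a b c e : R, [|| a != 0, b != 0 | c != 0] ->
  mu [set x | aff a b c e x = 0] = 0%E.

Lemma eight_partition_R3 : exists a b e a' b' e' p q r s : R,
  [/\ a * b' - a' * b != 0, [|| p != 0, q != 0 | r != 0] &
  forall e1 e2 e3, e1 * e1 = 1 -> e2 * e2 = 1 -> e3 * e3 = 1 ->
  mass mu (half e1 (aff a b 0 e) `&` half e2 (aff a' b' 0 e') `&` half e3 (aff p q r s)) =
  mass mu setT / 8].
Proof.
(* Without mass the octants of the limit may be empty and its planes degenerate, so the coordinate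
   planes are used instead. *)
have [M0|M0] := eqVneq (mass mu setT) 0.
  exists 1, 0, 0, 0, 1, 0, 0, 0, 1, 0; split.
  - by rewrite mulr1 mulr0 subr0 oner_eq0.
  - by rewrite oner_eq0 !orbT.
  - move=> e1 e2 e3 _ _ _; rewrite M0 mul0r; apply/eqP; rewrite eq_le mass_ge0 andbT.
    rewrite -M0; apply: le_mass => //.
    by apply: measurableI; [apply: measurableI|]; apply: measurable_half;
      exact: measurable_aff.
have [[[k1 k2] k3] [/= k1z k2z H]] := limit_partition mu_fin mu_plane.
have octant_neq0 e1 e2 e3 : e1 * e1 = 1 -> e2 * e2 = 1 -> e3 * e3 = 1 ->
    exists x, [/\ 0 < e1 * ev k1 x, 0 < e2 * ev k2 x & 0 < e3 * ev k3 x].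
  move=> ee1 ee2 ee3; have := H e1 e2 e3 ee1 ee2 ee3.
  have [->|/set0P[x [[x1 x2] x3]] _] := eqVneq (octant e1 e2 e3 (k1, k2, k3)) set0.
    rewrite mass_set0 => /esym/eqP; rewrite mulf_eq0 (negbTE M0) invr_eq0 /=.
    by rewrite pnatr_eq0.
  by exists x.
have one2 : (1 : R) * 1 = 1 by rewrite mulr1.
have mone2 : (-1 : R) * -1 = 1 by rewrite mulrNN mulr1.
have dt : k1.1.1.1 * k2.1.1.2 - k2.1.1.1 * k1.1.1.2 != 0.
  apply: indep_of_octants => // e1 e2 ee1 ee2.
  by have [x [? ? _]] := octant_neq0 e1 e2 1 ee1 ee2 one2; exists x.
exists k1.1.1.1, k1.1.1.2, k1.2, k2.1.1.1, k2.1.1.2, k2.2,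
  k3.1.1.1, k3.1.1.2, k3.1.2, k3.2; split => //.
  (* A constant third functional cannot be positive on one octant and negative on another, yet every
     octant has a point. *)
  apply: contraT; rewrite !negb_or !negbK => /and3P[/eqP p0 /eqP q0 /eqP r0].
  have [x [_ _]] := octant_neq0 1 1 1 one2 one2 one2.
  have [y [_ _]] := octant_neq0 1 1 (-1) one2 one2 mone2.
  rewrite /ev /aff p0 q0 r0 !mul0r !add0r mul1r mulN1r oppr_gt0 => h1 h2.
  by move: (lt_trans h1 h2); rewrite ltxx.
move=> e1 e2 e3 ee1 ee2 ee3; rewrite -(H e1 e2 e3 ee1 ee2 ee3) /octant /ev /=.
by rewrite k1z k2z.
Qed.

End eight_partition_R3.

(** * Linear coordinates adapted to the direction [v] *)

Section frame.
Context {R : realType}.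
Implicit Types u w x y : 'rV[R]_3.

Lemma dotDr u x y : dot u (x + y) = dot u x + dot u y.
Proof. by rewrite /dot -big_split; apply: eq_bigr => i _; rewrite mxE mulrDr. Qed.

Lemma dotZr u a x : dot u (a *: x) = a * dot u x.
Proof. by rewrite /dot big_distrr; apply: eq_bigr => i _; rewrite mxE /=; ring. Qed.

Lemma dotC u x : dot u x = dot x u.
Proof. by apply: eq_bigr => i _; rewrite mulrC. Qed.

Lemma dotDl u x y : dot (x + y) u = dot x u + dot y u.
Proof. by rewrite dotC dotDr !(dotC u). Qed.

Lemma dotZl u a x : dot (a *: x) u = a * dot x u.
Proof. by rewrite dotC dotZr dotC. Qed.

Lemma dot_delta i x : dot (delta_mx 0 i) x = x 0 i.
Proof.
rewrite /dot (bigD1 i)//= big1 ?addr0 ?mxE ?eqxx ?mul1r// => j ji.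
by rewrite mxE (negbTE ji) andbF mul0r.
Qed.

(** Indices are added modulo 3, so that any non-zero coordinate of [v] can play the role of the
    first one. *)
Lemma dot_cyclic (i : 'I_3) u w :
  dot u w = u 0 i * w 0 i + u 0 (i + 1) * w 0 (i + 1) + u 0 (i + 2) * w 0 (i + 2).
Proof.
have dotE : dot u w = u 0 0 * w 0 0 + u 0 1 * w 0 1 + u 0 2 * w 0 2.
  rewrite /dot !big_ord_recl big_ord0 addr0 addrA.
  by congr (_ + _ * _ + _ * _); congr (_ _ _); apply/val_inj.
have : [|| i == 0, i == 1 | i == 2] by case: i => [[|[|[|]]]].
case/or3P => /eqP ->; rewrite dotE.
- by rewrite !add0r.
- have -> : 1 + 1 = 2 :> 'I_3 by apply/val_inj.
  have -> : 1 + 2 = 0 :> 'I_3 by apply/val_inj.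
  by ring.
- have -> : 2 + 1 = 0 :> 'I_3 by apply/val_inj.
  have -> : 2 + 2 = 1 :> 'I_3 by apply/val_inj.
  by ring.
Qed.

Lemma frame_exists (v : 'rV[R]_3) : dot v v = 1 -> exists u1 u2 : 'rV[R]_3,
  [/\ dot u1 v = 0, dot u2 v = 0,
    forall s1 s2 s3, exists x, [/\ dot u1 x = s1, dot u2 x = s2 & dot v x = s3] &
    forall x, dot u1 x = 0 -> dot u2 x = 0 -> x = dot v x *: v].
Proof.
move=> v1.
have [i vi] : exists i, v 0 i != 0.
  apply: contrapT => nv; move: v1; rewrite /dot big1 => [/esym/eqP|i _].
    by rewrite oner_eq0.
  have [->|vi] := eqVneq (v 0 i) 0; first by rewrite mul0r.
  by exfalso; apply: nv; exists i.
(* These vectors are orthogonal to [v]; a vector killed by both has coordinates proportional to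
   those of [v]. *)
pose u j : 'rV[R]_3 := v 0 i *: delta_mx 0 j + (- v 0 j) *: delta_mx 0 i.
have uE j x : dot (u j) x = v 0 i * x 0 j - v 0 j * x 0 i.
  by rewrite dotDl !dotZl !dot_delta mulNr.
have := v1; rewrite (dot_cyclic i); set j := i + 1; set k := i + 2 => vv.
have ij : i != j by rewrite -subr_eq0 /j opprD addNKr oppr_eq0.
exists (u j), (u k); split.
- by rewrite uE mulrC subrr.
- by rewrite uE mulrC subrr.
(* The value [xi] of coordinate [i] is forced: multiply [dot v x = s3] by [v 0 i], eliminate the
   other two coordinates and use [dot v v = 1]. *)
- move=> s1 s2 s3; pose xi := v 0 i * s3 - v 0 j * s1 - v 0 k * s2.
  pose x : 'rV[R]_3 := xi *: delta_mx 0 i + ((s1 + v 0 j * xi) / v 0 i) *: delta_mx 0 j +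
    ((s2 + v 0 k * xi) / v 0 i) *: delta_mx 0 k.
  have ik : i != k by rewrite -subr_eq0 /k opprD addNKr oppr_eq0.
  have jk : j != k by rewrite /j /k (inj_eq (addrI _)).
  have xiE : x 0 i = xi.
    by rewrite !mxE !eqxx (negbTE ij) (negbTE ik) !mulr0 !addr0 mulr1.
  have xjE : x 0 j = (s1 + v 0 j * xi) / v 0 i.
    by rewrite !mxE !eqxx eq_sym (negbTE ij) (negbTE jk) !mulr0 !addr0 add0r mulr1.
  have xkE : x 0 k = (s2 + v 0 k * xi) / v 0 i.
    by rewrite !mxE !eqxx ![k == _]eq_sym (negbTE ik) (negbTE jk) !mulr0 !add0r mulr1.
  exists x; rewrite !uE (dot_cyclic i) -/j -/k xiE xjE xkE; split.
  + by field.
  + by field.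
  + apply: (mulfI vi).
    have -> : v 0 i * (v 0 i * xi + v 0 j * ((s1 + v 0 j * xi) / v 0 i) +
        v 0 k * ((s2 + v 0 k * xi) / v 0 i)) =
        (v 0 i * v 0 i + v 0 j * v 0 j + v 0 k * v 0 k) * xi + v 0 j * s1 + v 0 k * s2.
      by field.
    by rewrite vv /xi; ring.
- move=> x; rewrite !uE => /eqP; rewrite subr_eq0 => /eqP xj /eqP.
  rewrite subr_eq0 => /eqP xk.
  have dE : v 0 i * dot v x = x 0 i.
    rewrite (dot_cyclic i) -/j -/k.
    have -> : v 0 i * (v 0 i * x 0 i + v 0 j * x 0 j + v 0 k * x 0 k) =
      v 0 i * v 0 i * x 0 i + v 0 j * (v 0 i * x 0 j) + v 0 k * (v 0 i * x 0 k) by ring.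
    rewrite xj xk.
    have -> : v 0 i * v 0 i * x 0 i + v 0 j * (v 0 j * x 0 i) + v 0 k * (v 0 k * x 0 i) =
      (v 0 i * v 0 i + v 0 j * v 0 j + v 0 k * v 0 k) * x 0 i by ring.
    by rewrite vv mul1r.
  have lijk l : [|| l == i, l == j | l == k].
    by rewrite /j /k; case: i l {vi u uE vv j k ij xj xk dE} => [[|[|[|]]]//= ?] [[|[|[|]]]].
  apply/rowP => l; rewrite mxE; apply: (mulfI vi); rewrite [RHS]mulrA dE.
  by case/or3P: (lijk l) => /eqP ->; rewrite ?xj ?xk mulrC.
Qed.

End frame.

(** * Transfer to the given sigma-algebra and direction *)

Lemma continuous_dot {R : realType} (w : 'rV[R]_3) : continuous (dot w).
Proof.
apply: (continuous_big (@add_continuous R)) => i _ x.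
exact: (cvgM (@cvg_cst _ (w 0 i) _ (nbhs x) _) (@coord_continuous _ _ _ 0 i x)).
Qed.

Theorem theorem1p3 (R : realType) (G : set (set 'rV[R]_3))
    (mu : {finite_measure set (g_sigma_algebraType G) -> \bar R})
    (hmu : mass_distribution mu)
    (v : 'rV[R]_3) (hv : sphere2 v) :
  exists H1 H2 H3 : affine_plane R,
    eight_partition mu H1 H2 H3 /\
    exists p : 'rV[R]_3, plane_set H1 `&` plane_set H2 = line p v.
Proof.
have [open_meas plane0] := hmu.
have [u1 [u2 [u1v u2v surj ker]]] := frame_exists hv.
have mdot w : measurable_fun setT (fun x : g_sigma_algebraType G => dot w x).
  (* Open rays generate the Borel sets of [R], and their preimages are open, hence measurable by
     hypothesis. *)
  refine (@measurability _ _ (g_sigma_algebraType G) R setT (dot w) _ (RGenOInfty.measurableE R) _).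
  move=> _ [_ [r ->] <-]; rewrite setTI; apply: open_meas.
  by apply: open_comp => [x _|]; [exact: continuous_dot|exact: interval_open].
(* In these coordinates [v] points along the third axis, so vertical planes pull back to planes
   parallel to [v]. *)
pose F (x : g_sigma_algebraType G) : R * R * R := (dot u1 x, dot u2 x, dot v x).
have mF : measurable_fun setT F.
  by apply: measurable_fun_pair => //; exact: measurable_fun_pair.
pose nu : {measure set (R * R * R) -> \bar R} :=
  measure_function_pushforward__canonical__measure_function_Measure mu mF.
have nuE A : nu A = mu (F @^-1` A) by [].
have nu_fin : (nu setT < +oo)%E.
  by rewrite nuE preimage_setT -ge0_fin_numE// fin_num_measure.
pose comb (a b c : R) : 'rV[R]_3 := a *: u1 + b *: u2 + c *: v.
have dot_comb a b c x : dot (comb a b c) x = a * dot u1 x + b * dot u2 x + c * dot v x.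
  by rewrite /comb !dotDl !dotZl.
have comb_neq0 a b c : [|| a != 0, b != 0 | c != 0] -> comb a b c != 0.
  apply: contraTneq => c0.
  have sum0 s1 s2 s3 : a * s1 + b * s2 + c * s3 = 0.
    have [x [<- <- <-]] := surj s1 s2 s3.
    by rewrite -dot_comb c0 /dot big1// => i _; rewrite mxE mul0r.
  have := sum0 1 0 0; have := sum0 0 1 0; have := sum0 0 0 1.
  by rewrite !mulr0 !mulr1 !add0r !addr0 => -> -> ->; rewrite eqxx.
pose plane a b c e (abc : [|| a != 0, b != 0 | c != 0]) :=
  AffinePlane (- e) (comb_neq0 a b c abc).
have nu_plane a b c e : [|| a != 0, b != 0 | c != 0] ->
    nu [set x | aff a b c e x = 0] = 0%E.
  move=> abc; rewrite nuE -(plane0 (plane _ _ _ e abc)); congr (mu _).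
  by apply/seteqP; split => x; rewrite /plane_set /aff /F /= dot_comb => h; lra.
have [a [b [e [a' [b' [e' [p [q [r [s [dt pqr H]]]]]]]]]]] := eight_partition_R3 nu_fin nu_plane.
have ab : [|| a != 0, b != 0 | (0 : R) != 0].
  have [a0|//] := eqVneq a 0; have [b0|//] := eqVneq b 0.
  by move: dt; rewrite a0 b0 mul0r mulr0 subrr eqxx.
have ab' : [|| a' != 0, b' != 0 | (0 : R) != 0].
  have [a0|//] := eqVneq a' 0; have [b0|//] := eqVneq b' 0.
  by move: dt; rewrite a0 b0 mul0r mulr0 subrr eqxx.
exists (plane _ _ _ e ab), (plane _ _ _ e' ab'), (plane _ _ _ s pqr); split.
  pose sg (i : bool) : R := if i then 1 else -1.
  have sg2 i : sg i * sg i = 1 by case: i; rewrite /sg ?mulr1 ?mulrNN ?mulr1.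
  have halfE x1 x2 x3 t h i : halfspace (plane x1 x2 x3 t h) i =
      F @^-1` half (sg i) (aff x1 x2 x3 t).
    by apply/seteqP; case: i; split => x;
      rewrite /half /halfspace /sg /F /aff /= dot_comb => ?; lra.
  move=> i1 i2 i3; rewrite !halfE -!preimage_setI -nuE -[X in (mu X * _)%E](preimage_setT F).
  rewrite -nuE !(massE nu_fin)//; last first.
    by apply: measurableI; [apply: measurableI|]; apply: measurable_half;
      exact: measurable_aff.
  by rewrite H// EFinM.
(* The base point has the first two coordinates that Cramer's rule gives for the two plane
   equations; its third one is set to 0. *)
have [x0 [x1 x2 _]] := surj ((b * e' - b' * e) / (a * b' - a' * b))
  ((a' * e - a * e') / (a * b' - a' * b)) 0.
exists x0; apply/seteqP; split => x; rewrite /plane_set /line /= !dot_comb.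
- move=> [h1 h2]; exists (dot v (x - x0)).
  rewrite -[LHS](subrK x0) addrC; congr (_ + _).
  have dotB w : dot w (x - x0) = dot w x - dot w x0.
    by rewrite -scaleN1r dotDr dotZr mulN1r.
  (* Eliminating between the two plane equations shows that [x - x0] is killed by [u1] and [u2],
     hence is a multiple of [v]. *)
  apply: ker; rewrite dotB ?x1 ?x2; apply: (mulfI dt).
    have -> : (a * b' - a' * b) * (dot u1 x - (b * e' - b' * e) / (a * b' - a' * b)) =
      b' * (a * dot u1 x + b * dot u2 x + 0 * dot v x + e) -
      b * (a' * dot u1 x + b' * dot u2 x + 0 * dot v x + e') by field.
    by rewrite h1 h2; ring.
  have -> : (a * b' - a' * b) * (dot u2 x - (a' * e - a * e') / (a * b' - a' * b)) =
    a * (a' * dot u1 x + b' * dot u2 x + 0 * dot v x + e') -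
    a' * (a * dot u1 x + b * dot u2 x + 0 * dot v x + e) by field.
  by rewrite h1 h2; ring.
- move=> [t ->]; rewrite !dotDr !dotZr u1v u2v x1 x2 !mulr0 !addr0 !mul0r !addr0.
  by split; field.
Qed.
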